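(* Let $\Lambda$ be an immersed surface in $\mathbb{R}P^3$ (parametrised by a surface $\Sigma$) with global asymptotic coordinates $x,y$ and lift $\sigma$ satisfying $$\sigma_{xx}=\beta\sigma_y+\tfrac12(V-\beta_y)\sigma,\qquad \sigma_{yy}=\gamma\sigma_x+\tfrac12(W-\gamma_x)\sigma,$$ where $\beta,\gamma,V,W$ are functions and $\sigma,\sigma_x,\sigma_y,\sigma_{xy}$ are everywhere linearly independent. Then (the contact lift of) $\Lambda$ is M\''obius-flat if and only if there exist functions $a,b$ on $\Sigma$ such that \begin{align*} 2\beta_y b+\beta b_y&=2\gamma_x a+\gamma a_x,\\ 2b_x&=2\gamma\beta_y+\beta\gamma_y,\\ 2a_y&=2\beta\gamma_x+\gamma\beta_x. \end{align*}
   Context: Everything is smooth; subscripts $x,y$ denote partial derivatives. $\underline{\mathbb{R}}^{4}=\Sigma\times\mathbb{R}^{4}$ with trivial connection $d$; $\underline{\mathfrak g}=\Sigma\times\mathfrak{gl}(\mathbb{R}^{4})$. For endomorphism-valued one-forms, $[\alpha\wedge\beta]_{X,Y}=[\alpha_X,\beta_Y]-[\alpha_Y,\beta_X]$. A map into $\mathbb{R}P^3$ is identified with a line subbundle $\Lambda\subset\underline{\mathbb{R}}^4$. Its contact lift $E$ is the filtration $0\subset E_1=\Lambda\subset E_2\subset\underline{\mathbb{R}}^4$, where $E_2$ is the rank $3$ bundle spanned by the values of $\sigma$ and $d_X\sigma$ for $\sigma$ a section of $\Lambda$ and $X$ a vector field. Put $\underline{\mathfrak g}_{-2}=\{X: XE_2=0,\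 X\underline{\mathbb{R}}^{4}\subseteq E_1\}$, $\underline{\mathfrak g}_{-1}=\{X: XE_1=0,\ XE_2\subseteq E_1\}$, $\underline{\mathfrak g}_0=\{X: XE_1\subseteq E_1,\ XE_2\subseteq E_2\}$. A metric $g$ on $\underline{\mathbb{R}}^{4}$ is a non-degenerate symmetric bilinear form on the fibres (any signature). There is a unique decomposition $d=\mathcal{D}^g+\mathcal{N}^g$ with $\mathcal{D}^g$ a connection such that $\mathcal{D}^gg=0$ and $\mathcal{N}^g$ a one-form with $g$-symmetric values. Let $\mathfrak h\subset\underline{\mathfrak g}$ be the bundle of $g$-skew endomorphisms. $E$ envelopes $g$ if $E_1$ is $g$-null and $\mathcal{N}^g$ takes values in $\underline{\mathfrak g}_0$. $R^{\nabla}$ denotes curvature and $d^{\nabla}$ the exterior covariant derivative on endomorphism-valued forms. $E$ is M\''obius-flat if for some enveloped metric $g$ there exist one-forms $\chi^g\in\Omega^1(\Sigma,\underline{\mathfrak g}_{-1}\cap\mathfrak h)$ and $\psi^g\in\Omega^1(\Sigma,\underline{\mathfrak g}_{-2})$ with $d^{\mathcal{D}^g}\chi^g=R^{\mathcal{D}^g}$ and $d\psi^g+[\mathcal{N}^g\wedge\chi^g]=0$. *)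

(* Defs.v *)
From HB Require Import structures.
From mathcomp Require Import all_boot all_order all_algebra.
From mathcomp Require Import all_classical all_reals all_analysis.

Set Implicit Arguments.
Unset Strict Implicit.
Unset Printing Implicit Defensive.

Import Order.TTheory GRing.Theory Num.Theory.
Import numFieldNormedType.Exports.

Local Open Scope classical_set_scope.
Local Open Scope ring_scope.

(* Since the coordinates x, y are global, the surface is identified with an
   open set U of the (x, y)-plane, and the vector X = (X.1, X.2) stands for the
   tangent vector X.1 d/dx + X.2 d/dy.  Maps are total functions on R * R, but
   only their restriction to U is ever constrained. *)

Definition pdx (R : realType) (V : normedModType R) (f : R * R -> V) :
  R * R -> V := fun p => 'D_((1, 0) : R * R) f p.

Definition pdy (R : realType) (V : normedModType R) (f : R * R -> V) :
  R * R -> V := fun p => 'D_((0, 1) : R * R) f p.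

Fixpoint Ck (R : realType) (V : normedModType R) (U : set (R * R)) (k : nat)
    (f : R * R -> V) : Prop :=
  match k with
  | 0%N => forall p, U p -> {for p, continuous f}
  | k'.+1 => (forall p, U p -> differentiable f p) /\
             (forall X : R * R, Ck U k' (fun p => 'D_X f p))
  end.

Definition smooth (R : realType) (V : normedModType R) (U : set (R * R))
  (f : R * R -> V) : Prop := forall k, Ck U k f.

Definition linspan (R : realType) (V : lmodType R) (S : set V) : set V :=
  [set v | exists (n : nat) (c : 'I_n -> R) (u : 'I_n -> V),
      (forall i, S (u i)) /\ v = \sum_(i < n) c i *: u i].

(* A line subbundle of the trivial bundle U x R^4 is given by its fibres
   L p : set 'cV[R]_4. *)
Section ContactLift.
Variables (R : realType) (U : set (R * R)) (L : R * R -> set 'cV[R]_4).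

Definition is_lift (s : R * R -> 'cV[R]_4) : Prop :=
  smooth U s /\
  forall p, U p -> s p != 0 /\ L p = [set v | exists c : R, v = c *: s p].

Definition bundle_section (s : R * R -> 'cV[R]_4) : Prop :=
  smooth U s /\ forall p, U p -> L p (s p).

Definition E1 (p : R * R) : set 'cV[R]_4 := L p.

Definition E2 (p : R * R) : set 'cV[R]_4 :=
  linspan [set v | exists2 s, bundle_section s &
                     v = s p \/ exists X : R * R, v = 'D_X s p].

Definition gm2 (p : R * R) : set 'M[R]_4 :=
  [set A | (forall v, E2 p v -> A *m v = 0) /\ (forall v, E1 p (A *m v))].

Definition gm1 (p : R * R) : set 'M[R]_4 :=
  [set A | (forall v, E1 p v -> A *m v = 0) /\
           (forall v, E2 p v -> E1 p (A *m v))].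

Definition g0 (p : R * R) : set 'M[R]_4 :=
  [set A | (forall v, E1 p v -> E1 p (A *m v)) /\
           (forall v, E2 p v -> E2 p (A *m v))].

End ContactLift.

(* Endomorphism-valued forms are evaluated on tangent vectors: alpha p X for a
   one-form, Omega p X Y for a two-form. *)
Section Forms.
Variables (R : realType) (U : set (R * R)).

Definition form1 : Type := R * R -> R * R -> 'M[R]_4.

Definition one_form (P : R * R -> set 'M[R]_4) (alpha : form1) : Prop :=
  [/\ forall p, U p -> forall (c : R) (X Y : R * R),
        alpha p (c *: X + Y) = c *: alpha p X + alpha p Y,
      forall X : R * R, smooth U (fun p => alpha p X)
    & forall p X, U p -> P p (alpha p X)].

Definition commutator (A B : 'M[R]_4) : 'M[R]_4 := A *m B - B *m A.

Definition wedge_bracket (alpha beta : form1) (p X Y : R * R) : 'M[R]_4 :=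
  commutator (alpha p X) (beta p Y) - commutator (alpha p Y) (beta p X).

(* X and Y are constant vector fields, so the term alpha_[X,Y] vanishes. *)
Definition ext_d (alpha : form1) (p X Y : R * R) : 'M[R]_4 :=
  'D_X (fun q => alpha q Y) p - 'D_Y (fun q => alpha q X) p.

(* A connection on the trivial bundle is d + omega; it is represented by its
   connection form omega. *)
Definition covd (omega : form1) (s : R * R -> 'cV[R]_4) (p X : R * R) :
  'cV[R]_4 := 'D_X s p + omega p X *m s p.

Definition cov_ext_d (omega alpha : form1) (p X Y : R * R) : 'M[R]_4 :=
  ext_d alpha p X Y + wedge_bracket omega alpha p X Y.

Definition curvature (omega : form1) (p X Y : R * R) : 'M[R]_4 :=
  ext_d omega p X Y + commutator (omega p X) (omega p Y).

End Forms.

Section Metrics.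
Variables (R : realType) (U : set (R * R)).

Definition bform (G : 'M[R]_4) (u v : 'cV[R]_4) : R :=
  (u^T *m G *m v) ord0 ord0.

Definition is_metric (g : R * R -> 'M[R]_4) : Prop :=
  smooth U g /\ forall p, U p -> (g p)^T = g p /\ g p \in unitmx.

Definition gsym (G : 'M[R]_4) : set 'M[R]_4 :=
  [set A | forall u v, bform G (A *m u) v = bform G u (A *m v)].

Definition gskew (G : 'M[R]_4) : set 'M[R]_4 :=
  [set A | forall u v, bform G (A *m u) v = - bform G u (A *m v)].

Definition metric_connection (g : R * R -> 'M[R]_4) (omega : form1 R) : Prop :=
  forall s t : R * R -> 'cV[R]_4, smooth U s -> smooth U t ->
  forall p X, U p ->
    'D_X (fun q => bform (g q) (s q) (t q)) p =
    bform (g p) (covd omega s p X) (t p) + bform (g p) (s p) (covd omega t p X).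

(* The decomposition d = D^g + N^g, where D^g = d + omega. *)
Definition metric_decomposition (g : R * R -> 'M[R]_4) (omega N : form1 R) :
  Prop :=
  [/\ one_form U (fun=> setT) omega,
      metric_connection g omega,
      one_form U (fun p => gsym (g p)) N
    & forall s : R * R -> 'cV[R]_4, smooth U s -> forall p X, U p ->
        'D_X s p = covd omega s p X + N p X *m s p].

Variable L : R * R -> set 'cV[R]_4.

(* To be used with N = N^g. *)
Definition envelopes (g : R * R -> 'M[R]_4) (N : form1 R) : Prop :=
  (forall p, U p -> forall u v, E1 L p u -> E1 L p v -> bform (g p) u v = 0) /\
  (forall p X, U p -> g0 U L p (N p X)).

Definition mobius_flat : Prop :=
  exists (g : R * R -> 'M[R]_4) (omega N : form1 R),
  [/\ is_metric g, metric_decomposition g omega N, envelopes g N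
    & exists chi psi : form1 R,
      [/\ one_form U (fun p => gm1 U L p `&` gskew (g p)) chi,
          one_form U (gm2 U L) psi,
          forall p X Y, U p -> cov_ext_d omega chi p X Y = curvature omega p X Y
        & forall p X Y, U p ->
            ext_d psi p X Y + wedge_bracket N chi p X Y = 0]].

End Metrics.

(* Main.v *)
Require Import Defs.
From HB Require Import structures.
From mathcomp Require Import all_boot all_order all_algebra.
From mathcomp Require Import all_classical all_reals all_analysis.
From mathcomp Require Import ring lra.

(** Write d = D + N for the decomposition given by an enveloped metric g, and
    theta = chi + psi. Since d g = - 2 g N, the symmetry of second derivatives
    gives R^D = - [N_X, N_Y] (curvature_nonmetricity). As D = d - N, adding the
    two equations of Moebius-flatness cancels the brackets of N with chi and
    leaves the single equation d theta = - [N_X, N_Y].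

    This equation becomes explicit in a suitable frame. The envelope condition
    forces the Gram matrix of sigma, sigma_x, sigma_y, sigma_xy to vanish above
    its antidiagonal, which consists of f, - f, - f and f with f nowhere zero
    (gram_frame0, bform_sigma_s3_neq0). Replacing sigma_xy by
    sigma_xy + e sigma_x + c sigma_y + t sigma then brings it to f J with a
    constant antidiagonal J (exists_adapted_frame). In that frame N is, up to a scalar
    that commutators do not see, the J-symmetric part of the connection matrix
    (nonmetricity_frame), and theta is a strictly triangular matrix
    theta4(u, v, w) (gm1_gm2_frame).

    The entries of the resulting matrix equation (structure_eq) express all
    coefficients of theta by the value u1 of u on d/dx and the value v2 of v on
    d/dy, and leave a differential system for these two functions
    (structure_eq_algebraic, structure_eq_pde). In terms of
    a = u1 - (e beta - c^2 / 2) / 2 and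
    b = v2 - (c gamma - e^2 / 2) / 2 the parameters of the metric disappear and
    the system is the one of the theorem; this proves necessity.

    Conversely, given a and b, the metric with Gram matrix J in the coordinate
    frame (c = e = t = 0 and f = 1) is enveloped, and the computation read
    backwards provides chi and psi (sufficiency). There the first equation of
    the system gives d psi + [N /\ chi] = 0 separately (psi_equation), and the
    equation for chi follows by subtraction. *)

Set Implicit Arguments.
Unset Strict Implicit.
Unset Printing Implicit Defensive.

Import Order.TTheory GRing.Theory Num.Theory.
Import numFieldNormedType.Exports.

Local Open Scope classical_set_scope.
Local Open Scope ring_scope.

(** * Smooth functions on an open set of the plane *)

Section Smoothness.
Variables (R : realType) (U : set (R * R)).
Hypothesis hU : open U.

Lemma near_open p : U p -> \forall q \near p, U q.
Proof. by move=> Up; apply: open_nbhs_nbhs. Qed.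

(** The expansion that defines the differential only involves the germ of the
    function, so the differential of f also serves g. *)
Lemma differentiable_near (V W : normedModType R) (f g : V -> W) p :
  {near p, f =1 g} -> differentiable f p -> differentiable g p.
Proof.
move=> fg df.
have gd : forall q, g q = g (lim (nbhs p)) + 'd f p (q - lim (nbhs p))
                  +o_(q \near p) (q - lim (nbhs p)).
  suff /eqaddoP : forall e : R, 0 < e -> \forall q \near p,
      `|(g - (cst (g (lim (nbhs p))) + 'd f p \o center (lim (nbhs p)))) q| <=
      e * `|center (lim (nbhs p)) q|.
    by rewrite funeqE; exact.
  move=> _/posnumP[e].
  have [[_ /eqaddoP/(_ _ (gt0 e))]] := df => fe.
  near=> q; rewrite 2!fctE /= -(_ : f q = g q); last by near: q.
  have -> : g (lim (nbhs p)) = f (lim (nbhs p)).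
    by rewrite lim_id//; exact/esym/(nbhs_singleton fg).
  by near: q; exact: fe.
apply/diffP; apply: (@getPex _ (fun (d : {linear V -> W}) => continuous d /\
  forall q, g q = g (lim (nbhs p)) + d (q - lim (nbhs p))
                  +o_(q \near p) (q - lim (nbhs p)))).
by exists ('d f p); split => //; exact: diff_continuous.
Unshelve. all: by end_near. Qed.

Section NormedModules.
Variable V : normedModType R.
Implicit Types f g : R * R -> V.

Lemma derive_eqU f g X p : (forall q, U q -> f q = g q) -> U p ->
  'D_X f p = 'D_X g p.
Proof.
move=> fg Up; apply: near_eq_derive.
by near=> q; apply: fg; near: q; exact: near_open.
Unshelve. all: by end_near. Qed.

Lemma differentiable_eqU f g p : (forall q, U q -> f q = g q) -> U p ->
  differentiable f p -> differentiable g p.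
Proof.
move=> fg Up; apply: differentiable_near.
by near=> q; apply: fg; near: q; exact: near_open.
Unshelve. all: by end_near. Qed.

(** Functions are total but only constrained on U; since U is open, being of
    class C^k on U and the derivatives on U only depend on the values on U. *)
Lemma Ck_eqU k f g : (forall q, U q -> f q = g q) -> Ck U k f -> Ck U k g.
Proof.
elim: k f g => [|k IH] f g fg /=.
  move=> cf p Up; have := cf p Up; rewrite /prop_for /continuous_at -fg//.
  apply: cvg_trans; apply: near_eq_cvg.
  by near=> q; rewrite fg//; near: q; exact: near_open.
move=> [df Df]; split=> [p Up|X]; first exact: differentiable_eqU fg Up (df p Up).
by apply: IH (Df X) => q Uq; exact: derive_eqU.
Unshelve. all: by end_near. Qed.

Lemma smooth_eqU f g : (forall q, U q -> f q = g q) ->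
  smooth U f -> smooth U g.
Proof. by move=> fg sf k; apply: Ck_eqU (sf k). Qed.

Lemma Ck_pred k f : Ck U k.+1 f -> Ck U k f.
Proof.
elim: k f => [f [df _] p Up|k IH f [df Df]].
  exact/differentiable_continuous/df.
by split=> // X; apply: IH.
Qed.

Lemma smooth_differentiable f p : smooth U f -> U p -> differentiable f p.
Proof. by move=> /(_ 1%N)[+ _]; exact. Qed.

Lemma smooth_derive f X : smooth U f -> smooth U (fun p => 'D_X f p).
Proof. by move=> sf k; have [_] := sf k.+1; exact. Qed.

Lemma Ck_cst k (v : V) : Ck U k (fun=> v).
Proof.
elim: k v => [|k IH] v /=; first by move=> p _; exact: cvg_cst.
split=> [p _|X]; first exact: differentiable_cst.
by apply: Ck_eqU (IH 0) => p _; rewrite derive_cst.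
Qed.

Lemma smooth_cst (v : V) : smooth U (fun=> v).
Proof. by move=> k; exact: Ck_cst. Qed.

Lemma derive_xy f (X : R * R) p : differentiable f p ->
  'D_X f p = X.1 *: pdx f p + X.2 *: pdy f p.
Proof.
move=> df; rewrite /pdx /pdy !deriveE// -!linearZ -linearD; congr ('d f p _).
case: X => a b; rewrite -[LHS]/(a, b) /=; apply/eqP; rewrite xpair_eqE /=.
by rewrite !scaler0 add0r addr0 /GRing.scale /= !mulr1 !eqxx.
Qed.

End NormedModules.

Section ScalarFunctions.
Implicit Types f g : R * R -> R.

Lemma derivefD f g X p : differentiable f p -> differentiable g p ->
  'D_X (fun q => f q + g q) p = 'D_X f p + 'D_X g p.
Proof.
by move=> df dg; apply: (@deriveD _ _ _ f g); exact: diff_derivable.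
Qed.

Lemma derivefM f g X p : differentiable f p -> differentiable g p ->
  'D_X (fun q => f q * g q) p = 'D_X f p * g p + f p * 'D_X g p.
Proof.
move=> df dg.
have := @deriveM _ _ f g p X; move=> /(_ (diff_derivable df)) /(_ (diff_derivable dg)).
by rewrite /GRing.scale /= addrC [g p * _]mulrC; exact.
Qed.

Lemma CkD k f g : Ck U k f -> Ck U k g -> Ck U k (fun p => f p + g p).
Proof.
elim: k f g => [|k IH] f g.
  by move=> cf cg p Up; apply: continuousD; [exact: cf|exact: cg].
move=> [df Df] [dg Dg]; split=> [p Up|X].
  by apply: differentiableD; [exact: df|exact: dg].
apply: Ck_eqU (IH _ _ (Df X) (Dg X)) => p Up.
by rewrite derivefD//; [exact: df|exact: dg].
Qed.

Lemma CkM k f g : Ck U k f -> Ck U k g -> Ck U k (fun p => f p * g p).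
Proof.
elim: k f g => [|k IH] f g.
  by move=> cf cg p Up; apply: continuousM; [exact: cf|exact: cg].
move=> Cf Cg; move: (Cf) (Cg) => [df Df] [dg Dg]; split=> [p Up|X].
  by apply: differentiableM; [exact: df|exact: dg].
apply: Ck_eqU (CkD (IH _ _ (Df X) (Ck_pred Cg)) (IH _ _ (Ck_pred Cf) (Dg X))).
by move=> p Up; rewrite derivefM//; [exact: df|exact: dg].
Qed.

Lemma CkV k f : (forall p, U p -> f p != 0) -> Ck U k f ->
  Ck U k (fun p => (f p)^-1).
Proof.
move=> f0; elim: k => [|k IH].
  by move=> cf p Up; apply: continuousV; [exact: f0|exact: cf].
move=> Cf; have [df Df] := Cf; split=> [p Up|X].
  by apply: differentiableV; [exact: df|exact: f0].
have IHf := IH (Ck_pred Cf).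
apply: (@Ck_eqU _ _ (fun p => -1 * (f p)^-1 * (f p)^-1 * 'D_X f p)).
  move=> p Up; rewrite (@deriveV _ _ f)//; [|exact: f0|exact/diff_derivable/df].
  by rewrite /GRing.scale /= mulN1r !mulNr expr2 invfM.
apply: CkM (Df X); apply: CkM (IHf); apply: CkM (IHf); exact: Ck_cst.
Qed.

Lemma smoothD f g : smooth U f -> smooth U g -> smooth U (fun p => f p + g p).
Proof. by move=> sf sg k; exact: CkD. Qed.

Lemma smoothM f g : smooth U f -> smooth U g -> smooth U (fun p => f p * g p).
Proof. by move=> sf sg k; exact: CkM. Qed.

Lemma smoothV f : (forall p, U p -> f p != 0) -> smooth U f ->
  smooth U (fun p => (f p)^-1).
Proof. by move=> f0 sf k; exact: CkV. Qed.

Lemma smoothN f : smooth U f -> smooth U (fun p => - f p).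
Proof.
move=> sf; apply: (@smooth_eqU _ (fun p => -1 * f p)) => [p _|]; first by rewrite mulN1r.
by apply: smoothM sf; exact: smooth_cst.
Qed.

Lemma smoothB f g : smooth U f -> smooth U g -> smooth U (fun p => f p - g p).
Proof. by move=> sf sg; apply: smoothD sf (smoothN sg). Qed.

Lemma smooth_sum (I : Type) (r : seq I) (F : I -> R * R -> R) :
  (forall i, smooth U (F i)) -> smooth U (fun p => \sum_(i <- r) F i p).
Proof.
move=> sF; elim: r => [|i r IH].
  apply: (@smooth_eqU _ (fun=> 0)) => [p _|]; first by rewrite big_nil.
  exact: smooth_cst.
by apply: smooth_eqU (smoothD (sF i) IH) => p _; rewrite big_cons.
Qed.

Lemma smooth_prod (I : Type) (r : seq I) (F : I -> R * R -> R) :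
  (forall i, smooth U (F i)) -> smooth U (fun p => \prod_(i <- r) F i p).
Proof.
move=> sF; elim: r => [|i r IH].
  apply: (@smooth_eqU _ (fun=> 1 : R)) => [p _|]; first by rewrite big_nil.
  exact: smooth_cst.
by apply: smooth_eqU (smoothM (sF i) IH) => p _; rewrite big_cons.
Qed.

End ScalarFunctions.
End Smoothness.

(** * Symmetry of second derivatives *)

Section Schwarz.
Variables (R : realType) (U : set (R * R)).
Hypothesis hU : open U.

(** Restriction to a line reduces directional derivatives to the mean value
    theorem in one variable. *)
Lemma is_derive_line (f : R * R -> R) (q X : R * R) (s : R) :
  differentiable f (q + s *: X) ->
  is_derive s 1 (fun t : R => f (q + t *: X)) ('D_X f (q + s *: X)).
Proof.
move=> df.
have E : (fun h : R => h^-1 *: (((fun t : R => f (q + t *: X)) \o shift s)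
            (h *: (1 : R)) - f (q + s *: X))) =
         (fun h : R => h^-1 *: ((f \o shift (q + s *: X)) (h *: X)
            - f (q + s *: X))).
  apply/funext => h /=; congr (_ *: (f _ - _)).
  by rewrite scalerDl /GRing.scale /= mulr1 addrCA.
split; first by rewrite /derivable E; exact: diff_derivable.
by rewrite /derive E.
Qed.

Lemma mvt (f df : R -> R) (a b : R) : a < b ->
  (forall x, a <= x <= b -> is_derive x 1 f (df x)) ->
  exists2 c, c \in `]a, b[%R & f b - f a = df c * (b - a).
Proof.
move=> ab fdf; apply: MVT ab _ _ => [x|].
  by rewrite in_itv/= => /andP[ax xb]; apply: fdf; rewrite !ltW.
apply: continuous_in_subspaceT => x.
rewrite inE/= in_itv/= => /fdf[+ _].
by move=> /derivable1_diffP/differentiable_continuous.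
Qed.

(** Mean value theorem twice: along X for the increment in the direction Y,
    then along Y for the derivative in the direction X. *)
Lemma second_difference (f : R * R -> R) (p X Y : R * R) (h : R) :
  smooth U f -> 0 < h ->
  (forall s t : R, 0 <= s <= h -> 0 <= t <= h -> U (p + s *: X + t *: Y)) ->
  exists s t : R, [/\ 0 <= s <= h, 0 <= t <= h &
    f (p + h *: X + h *: Y) - f (p + h *: X) - f (p + h *: Y) + f p =
    h * h * 'D_Y (fun q => 'D_X f q) (p + s *: X + t *: Y)].
Proof.
move=> sf h0 hUp.
have h0h : 0 <= h <= h by rewrite lexx ltW.
have h00 : 0 <= (0 : R) <= h by rewrite lexx ltW.
pose phi s : R := f (p + h *: Y + s *: X) - f (p + s *: X).
pose dphi s : R := 'D_X f (p + h *: Y + s *: X) - 'D_X f (p + s *: X).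
have dphiE s : 0 <= s <= h -> is_derive s 1 phi (dphi s).
  move=> sh; apply: is_deriveB; apply: is_derive_line;
    apply: smooth_differentiable sf _.
    by rewrite addrAC; exact: hUp.
  by have := hUp s 0 sh h00; rewrite scale0r addr0.
have [s sh] : exists2 s, s \in `]0, h[%R & phi h - phi 0 = dphi s * (h - 0).
  by apply: mvt h0 _.
rewrite subr0 => phiE.
have {}sh : 0 <= s <= h by move: sh; rewrite in_itv/= => /andP[? ?]; rewrite !ltW.
pose psi t : R := 'D_X f (p + s *: X + t *: Y).
have dpsiE t : 0 <= t <= h ->
    is_derive t 1 psi ('D_Y (fun q => 'D_X f q) (p + s *: X + t *: Y)).
  move=> th; apply: is_derive_line.
  by apply: smooth_differentiable (smooth_derive X sf) _; exact: hUp.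
pose dpsi t : R := 'D_Y (fun q => 'D_X f q) (p + s *: X + t *: Y).
have [t th] : exists2 t, t \in `]0, h[%R & psi h - psi 0 = dpsi t * (h - 0).
  by apply: mvt h0 _.
rewrite subr0 => psiE.
exists s, t; split => //.
  by move: th; rewrite in_itv/= => /andP[? ?]; rewrite !ltW.
have : dphi s = psi h - psi 0.
  by rewrite /dphi /psi scale0r addr0 addrAC.
rewrite psiE [p + h *: X + h *: Y]addrAC => dE; move: phiE.
rewrite dE /phi scale0r !addr0 -/(dpsi t).
rewrite opprB addrA [LHS]addrAC => ->.
by rewrite -mulrA mulrC.
Qed.

Lemma small_parallelogram (P : R * R -> Prop) (p X Y : R * R) :
  (\forall q \near p, P q) ->
  exists2 h : R, 0 < h & forall s t : R,
    0 <= s <= h -> 0 <= t <= h -> P (p + s *: X + t *: Y).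
Proof.
move=> /nbhs_ballP[r /= r0 Pr].
pose m := `|X| + `|Y| + 1.
have m0 : 0 < m by rewrite ltr_wpDl// addr_ge0.
exists (r / 2 / m) => [|s t /andP[s0 sh] /andP[t0 th]].
  by rewrite !divr_gt0.
apply: Pr; rewrite -ball_normE /ball_/=.
rewrite -addrA opprD addrA subrr sub0r normrN.
apply: le_lt_trans (ler_normD _ _) _; rewrite !normrZ (ger0_norm s0) (ger0_norm t0).
apply: (@le_lt_trans _ _ (r / 2 / m * `|X| + r / 2 / m * `|Y|)).
  by apply: lerD; apply: ler_wpM2r.
apply: (@le_lt_trans _ _ (r / 2 / m * m)); last first.
  by rewrite mulfVK ?gt_eqF//; lra.
by rewrite -mulrDr ler_wpM2l ?divr_ge0 ?ltW// /m ltrDl.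
Qed.

Lemma smooth_near_dist2 (g k : R * R -> R) p (e : R) :
  smooth U g -> smooth U k -> U p -> 0 < e ->
  \forall q \near p, [/\ U q, `|g p - g q| <= e & `|k p - k q| <= e].
Proof.
move=> sg sk Up e0.
have /cvgr_dist_le/(_ _ e0) ng := sg 0%N p Up.
have /cvgr_dist_le/(_ _ e0) nk := sk 0%N p Up.
by apply: filterS3 (near_open hU Up) ng nk => q.
Qed.

(** Both functions are continuous at p and the parallelograms shrink to p. *)
Lemma parallelogram_eq (g k : R * R -> R) (p X Y : R * R) :
  smooth U g -> smooth U k -> U p ->
  (forall h : R, 0 < h ->
    (forall s t : R, 0 <= s <= h -> 0 <= t <= h -> U (p + s *: X + t *: Y)) ->
    exists s t s' t' : R, [/\ 0 <= s <= h, 0 <= t <= h, 0 <= s' <= h, 0 <= t' <= h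
      & g (p + s *: X + t *: Y) = k (p + s' *: X + t' *: Y)]) ->
  g p = k p.
Proof.
move=> sg sk Up gk; apply/eqP; rewrite -subr_eq0 -normr_eq0 eq_le normr_ge0.
rewrite andbT; apply/ler_addgt0Pr => e e0; rewrite add0r.
have e2 : 0 < e / 2 by rewrite divr_gt0.
have [h h0 Hh] := small_parallelogram X Y (smooth_near_dist2 sg sk Up e2).
have [s t sh th|s [t [s' [t' [sh th sh' th' E]]]]] := gk h h0.
  by have [] := Hh s t sh th.
have [_ g1 _] := Hh s t sh th; have [_ _ k1] := Hh s' t' sh' th'.
move: k1; rewrite -E distrC => k1.
by apply: le_trans (ler_distD _ _ _) _; rewrite [leRHS]splitr; apply: lerD g1 k1.
Qed.

(** The second difference of f over a parallelogram is symmetric in its two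
    sides, and by second_difference it is h^2 times a value near p of either
    mixed derivative. *)
Lemma derive_comm (f : R * R -> R) (X Y : R * R) p : smooth U f -> U p ->
  'D_Y (fun q => 'D_X f q) p = 'D_X (fun q => 'D_Y f q) p.
Proof.
move=> sf Up.
have sg : smooth U (fun q => 'D_Y (fun q => 'D_X f q) q).
  exact/smooth_derive/smooth_derive.
have sk : smooth U (fun q => 'D_X (fun q => 'D_Y f q) q).
  exact/smooth_derive/smooth_derive.
apply: (parallelogram_eq (X := X) (Y := Y) sg sk Up) => h h0 HU.
have [s [t [sh th E]]] := second_difference sf h0 HU.
have HU' (s' t' : R) : 0 <= s' <= h -> 0 <= t' <= h -> U (p + s' *: Y + t' *: X).
  by move=> hs ht; rewrite addrAC; exact: HU.
have [t' [s' [th' sh' E']]] := second_difference sf h0 HU'.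
exists s, t, s', t'; split; [exact: sh|exact: th|exact: sh'|exact: th'|].
have hh : h * h != 0 by rewrite mulf_neq0 ?gt_eqF.
rewrite (addrAC p (s' *: X)); apply: (mulfI hh).
apply: etrans (esym E) _; apply: etrans E'.
rewrite (addrAC p (h *: Y)); congr (_ + _); exact: addrAC.
Qed.

End Schwarz.

(** * Matrix-valued functions *)

Section MatrixFunctions.
Variables (R : realType) (U : set (R * R)).
Hypothesis hU : open U.

Lemma differentiable_mxP m n (M : R * R -> 'M[R]_(m, n)) p :
  differentiable M p <-> forall i j, differentiable (fun q => M q i j) p.
Proof.
split=> [dM i j|dM].
  exact: (differentiable_comp dM (differentiable_coord _ i j)).
have -> : M = \sum_(i < m) (\sum_(j < n) (fun q => M q i j *: delta_mx i j)).
  apply/funext => q; rewrite [LHS]matrix_sum_delta fct_sumE.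
  by apply: eq_bigr => i _; rewrite fct_sumE.
apply: differentiable_sum => i; apply: differentiable_sum => j.
exact: differentiableZl.
Qed.

Lemma derive_mxE m n (M : R * R -> 'M[R]_(m, n)) X p i j : differentiable M p ->
  'D_X M p i j = 'D_X (fun q => M q i j) p.
Proof. by move=> dM; rewrite derive_mx ?mxE//; exact: diff_derivable. Qed.

Lemma smooth_mxP m n (M : R * R -> 'M[R]_(m, n)) :
  smooth U M <-> forall i j, smooth U (fun p => M p i j).
Proof.
split=> [sM i j k|sM k].
  elim: k M sM => [|k IH] M sM.
    move=> p Up; apply: (@continuous_comp _ _ _ M (fun N => N i j)).
      exact: (sM 0%N).
    exact: coord_continuous.
  split=> [p Up|X].
    by have /differentiable_mxP := smooth_differentiable sM Up; exact.
  apply: (Ck_eqU hU _ (IH _ (smooth_derive X sM))) => p Up.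
  by rewrite derive_mxE//; exact: smooth_differentiable sM Up.
elim: k M sM => [|k IH] M sM.
  move=> p Up; apply/differentiable_continuous/differentiable_mxP => i j.
  exact: smooth_differentiable (sM i j) Up.
have dM p : U p -> differentiable M p.
  by move=> Up; apply/differentiable_mxP => i j; exact: smooth_differentiable (sM i j) Up.
split=> [//|X].
apply: (IH (fun p => 'D_X M p)) => i j.
apply: (smooth_eqU hU _ (smooth_derive X (sM i j))) => p Up.
by rewrite derive_mxE//; exact: dM.
Qed.

Lemma smooth_mulmx m n r (A : R * R -> 'M[R]_(m, n)) (B : R * R -> 'M[R]_(n, r)) :
  smooth U A -> smooth U B -> smooth U (fun p => A p *m B p).
Proof.
move=> /smooth_mxP sA /smooth_mxP sB; apply/smooth_mxP => i j.
apply: (@smooth_eqU _ _ hU _ (fun p => \sum_k A p i k * B p k j)) => [p _|].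
  by rewrite mxE.
by apply: smooth_sum => // k; exact: smoothM.
Qed.

Lemma smooth_trmx m n (A : R * R -> 'M[R]_(m, n)) :
  smooth U A -> smooth U (fun p => (A p)^T).
Proof.
move=> /smooth_mxP sA; apply/smooth_mxP => i j.
by apply: (smooth_eqU hU _ (sA j i)) => p _; rewrite mxE.
Qed.

Lemma smooth_addmx m n (A B : R * R -> 'M[R]_(m, n)) :
  smooth U A -> smooth U B -> smooth U (fun p => A p + B p).
Proof.
move=> /smooth_mxP sA /smooth_mxP sB; apply/smooth_mxP => i j.
by apply: (smooth_eqU hU _ (smoothD hU (sA i j) (sB i j))) => p _; rewrite mxE.
Qed.

Lemma smooth_scalemx m n (c : R * R -> R) (A : R * R -> 'M[R]_(m, n)) :
  smooth U c -> smooth U A -> smooth U (fun p => c p *: A p).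
Proof.
move=> sc /smooth_mxP sA; apply/smooth_mxP => i j.
by apply: (smooth_eqU hU _ (smoothM hU sc (sA i j))) => p _; rewrite mxE.
Qed.

Lemma smooth_oppmx m n (A : R * R -> 'M[R]_(m, n)) :
  smooth U A -> smooth U (fun p => - A p).
Proof.
move=> /smooth_mxP sA; apply/smooth_mxP => i j.
by apply: (smooth_eqU hU _ (smoothN hU (sA i j))) => p _; rewrite mxE.
Qed.

Lemma smooth_det n (A : R * R -> 'M[R]_n) :
  smooth U A -> smooth U (fun p => \det (A p)).
Proof.
move=> /smooth_mxP sA.
apply: smooth_sum => // s; apply: smoothM => //; first exact: smooth_cst.
exact: smooth_prod.
Qed.

Lemma smooth_invmx n (A : R * R -> 'M[R]_n) :
  (forall p, U p -> A p \in unitmx) ->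
  smooth U A -> smooth U (fun p => invmx (A p)).
Proof.
move=> uA sA; have sA' := (smooth_mxP _).1 sA; apply/smooth_mxP => i j.
apply: (@smooth_eqU _ _ hU _ (fun p => (\det (A p))^-1 * cofactor (A p) j i)).
  by move=> p Up; rewrite /invmx uA// !mxE.
apply: smoothM => //.
  apply: smoothV => //; last exact: smooth_det.
  by move=> p Up; rewrite -unitfE -unitmxE uA.
apply: smoothM => //; first exact: smooth_cst.
apply: smooth_det; apply/smooth_mxP => k l.
by apply: (smooth_eqU hU _ (sA' (lift j k) (lift i l))) => p _; rewrite !mxE.
Qed.

Lemma derive_mulmx m n r (A : R * R -> 'M[R]_(m, n)) (B : R * R -> 'M[R]_(n, r))
    X p : differentiable A p -> differentiable B p ->
  'D_X (fun q => A q *m B q) p = 'D_X A p *m B p + A p *m 'D_X B p.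
Proof.
move=> dA dB.
have dA' := (differentiable_mxP A p).1 dA.
have dB' := (differentiable_mxP B p).1 dB.
have E i j : (fun q => (A q *m B q) i j) =
   (\sum_k (fun q => A q i k * B q k j)).
  by apply/funext => q; rewrite mxE fct_sumE.
have dAB i j k : differentiable (fun q => A q i k * B q k j) p.
  exact: differentiableM.
have dM k l : differentiable (fun q => (A q *m B q) k l) p.
  by rewrite (E k l); apply: (differentiable_sum (dAB k l)).
apply/matrixP => i j; rewrite derive_mxE; last exact/differentiable_mxP.
rewrite E derive_sum; last by move=> k; exact: diff_derivable.
rewrite !mxE -big_split; apply: eq_bigr => k _ /=.
by rewrite derivefM// -!derive_mxE.
Qed.

Lemma derive_trmx m n (A : R * R -> 'M[R]_(m, n)) X p : differentiable A p ->
  'D_X (fun q => (A q)^T) p = ('D_X A p)^T.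
Proof.
move=> dA; have dA' := (differentiable_mxP A p).1 dA.
have E i j : (fun q => (A q)^T i j) = (fun q => A q j i).
  by apply/funext => q; rewrite mxE.
have dAT : differentiable (fun q => (A q)^T) p.
  by apply/differentiable_mxP => i j; rewrite E.
by apply/matrixP => i j; rewrite mxE (derive_mxE _ _ _ dAT) (derive_mxE _ _ _ dA) E.
Qed.

Lemma derive_comm_mx m n (M : R * R -> 'M[R]_(m, n)) (X Y : R * R) p :
  smooth U M -> U p ->
  'D_Y (fun q => 'D_X M q) p = 'D_X (fun q => 'D_Y M q) p.
Proof.
move=> sM Up; have sM' := (smooth_mxP M).1 sM.
apply/matrixP => i j.
have D2 Z W : 'D_W (fun q => 'D_Z M q) p i j =
    'D_W (fun q => 'D_Z (fun r => M r i j) q) p.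
  have dDM := smooth_differentiable (smooth_derive Z sM) Up.
  apply: etrans (derive_mxE _ _ _ dDM) _; apply: (derive_eqU hU _ _ Up) => q Uq.
  by have /derive_mxE := smooth_differentiable sM Uq; exact.
apply: etrans (D2 X Y) _; apply: etrans (esym (D2 Y X)).
exact: (derive_comm hU X Y (sM' i j) Up).
Qed.

End MatrixFunctions.

(** * Matrices in an adapted frame *)

Section FourByFour.
Variable K : realFieldType.

Definition m4 (a00 a01 a02 a03 a10 a11 a12 a13
               a20 a21 a22 a23 a30 a31 a32 a33 : K) : 'M[K]_4 :=
  \matrix_(i < 4, j < 4)
    nth 0 (nth [::] [:: [:: a00; a01; a02; a03]; [:: a10; a11; a12; a13];
                        [:: a20; a21; a22; a23]; [:: a30; a31; a32; a33]] i) j.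

Lemma ord4P (P : 'I_4 -> Prop) :
  P (inord 0) -> P (inord 1) -> P (inord 2) -> P (inord 3) -> forall i, P i.
Proof.
move=> h0 h1 h2 h3 j.
have /or4P : [|| val j == 0%N, val j == 1%N, val j == 2%N | val j == 3%N].
  by case: j => -[|[|[|[|]]]].
by case=> /eqP jE; rewrite -[j]inord_val jE.
Qed.

Lemma sum4 (V : nmodType) (f : 'I_4 -> V) :
  \sum_i f i = f (inord 0) + f (inord 1) + f (inord 2) + f (inord 3).
Proof.
rewrite !big_ord_recl big_ord0 addr0 !addrA.
by congr (f _ + f _ + f _ + f _); apply/val_inj; rewrite /= ?inordK.
Qed.

Lemma m4M a00 a01 a02 a03 a10 a11 a12 a13 a20 a21 a22 a23 a30 a31 a32 a33
  b00 b01 b02 b03 b10 b11 b12 b13 b20 b21 b22 b23 b30 b31 b32 b33 :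
  m4 a00 a01 a02 a03 a10 a11 a12 a13 a20 a21 a22 a23 a30 a31 a32 a33 *m
  m4 b00 b01 b02 b03 b10 b11 b12 b13 b20 b21 b22 b23 b30 b31 b32 b33 =
  m4 (a00 * b00 + a01 * b10 + a02 * b20 + a03 * b30)
     (a00 * b01 + a01 * b11 + a02 * b21 + a03 * b31)
     (a00 * b02 + a01 * b12 + a02 * b22 + a03 * b32)
     (a00 * b03 + a01 * b13 + a02 * b23 + a03 * b33)
     (a10 * b00 + a11 * b10 + a12 * b20 + a13 * b30)
     (a10 * b01 + a11 * b11 + a12 * b21 + a13 * b31)
     (a10 * b02 + a11 * b12 + a12 * b22 + a13 * b32)
     (a10 * b03 + a11 * b13 + a12 * b23 + a13 * b33)
     (a20 * b00 + a21 * b10 + a22 * b20 + a23 * b30)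
     (a20 * b01 + a21 * b11 + a22 * b21 + a23 * b31)
     (a20 * b02 + a21 * b12 + a22 * b22 + a23 * b32)
     (a20 * b03 + a21 * b13 + a22 * b23 + a23 * b33)
     (a30 * b00 + a31 * b10 + a32 * b20 + a33 * b30)
     (a30 * b01 + a31 * b11 + a32 * b21 + a33 * b31)
     (a30 * b02 + a31 * b12 + a32 * b22 + a33 * b32)
     (a30 * b03 + a31 * b13 + a32 * b23 + a33 * b33).
Proof.
by apply/matrixP; apply: ord4P; apply: ord4P; rewrite mxE sum4 !mxE !inordK.
Qed.

Lemma m4D a00 a01 a02 a03 a10 a11 a12 a13 a20 a21 a22 a23 a30 a31 a32 a33
  b00 b01 b02 b03 b10 b11 b12 b13 b20 b21 b22 b23 b30 b31 b32 b33 :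
  m4 a00 a01 a02 a03 a10 a11 a12 a13 a20 a21 a22 a23 a30 a31 a32 a33 +
  m4 b00 b01 b02 b03 b10 b11 b12 b13 b20 b21 b22 b23 b30 b31 b32 b33 =
  m4 (a00 + b00) (a01 + b01) (a02 + b02) (a03 + b03)
     (a10 + b10) (a11 + b11) (a12 + b12) (a13 + b13)
     (a20 + b20) (a21 + b21) (a22 + b22) (a23 + b23)
     (a30 + b30) (a31 + b31) (a32 + b32) (a33 + b33).
Proof.
by apply/matrixP; apply: ord4P; apply: ord4P; rewrite !mxE !inordK.
Qed.

Lemma m4Z k a00 a01 a02 a03 a10 a11 a12 a13 a20 a21 a22 a23 a30 a31 a32 a33 :
  k *: m4 a00 a01 a02 a03 a10 a11 a12 a13 a20 a21 a22 a23 a30 a31 a32 a33 =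
  m4 (k * a00) (k * a01) (k * a02) (k * a03) (k * a10) (k * a11) (k * a12)
     (k * a13) (k * a20) (k * a21) (k * a22) (k * a23) (k * a30) (k * a31)
     (k * a32) (k * a33).
Proof.
by apply/matrixP; apply: ord4P; apply: ord4P; rewrite !mxE !inordK.
Qed.

Lemma m4N a00 a01 a02 a03 a10 a11 a12 a13 a20 a21 a22 a23 a30 a31 a32 a33 :
  - m4 a00 a01 a02 a03 a10 a11 a12 a13 a20 a21 a22 a23 a30 a31 a32 a33 =
  m4 (- a00) (- a01) (- a02) (- a03) (- a10) (- a11) (- a12) (- a13)
     (- a20) (- a21) (- a22) (- a23) (- a30) (- a31) (- a32) (- a33).
Proof.
by apply/matrixP; apply: ord4P; apply: ord4P; rewrite !mxE !inordK.
Qed.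

Lemma m4T a00 a01 a02 a03 a10 a11 a12 a13 a20 a21 a22 a23 a30 a31 a32 a33 :
  (m4 a00 a01 a02 a03 a10 a11 a12 a13 a20 a21 a22 a23 a30 a31 a32 a33)^T =
  m4 a00 a10 a20 a30 a01 a11 a21 a31 a02 a12 a22 a32 a03 a13 a23 a33.
Proof.
by apply/matrixP; apply: ord4P; apply: ord4P; rewrite !mxE !inordK.
Qed.

Lemma scalar_m4 k : k%:M = m4 k 0 0 0 0 k 0 0 0 0 k 0 0 0 0 k.
Proof.
by apply/matrixP; apply: ord4P; apply: ord4P;
  rewrite !mxE -val_eqE /= !inordK// mulr1n || rewrite !mxE -val_eqE /= !inordK.
Qed.

Lemma m4_inj a00 a01 a02 a03 a10 a11 a12 a13 a20 a21 a22 a23 a30 a31 a32 a33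
  b00 b01 b02 b03 b10 b11 b12 b13 b20 b21 b22 b23 b30 b31 b32 b33 :
  m4 a00 a01 a02 a03 a10 a11 a12 a13 a20 a21 a22 a23 a30 a31 a32 a33 =
  m4 b00 b01 b02 b03 b10 b11 b12 b13 b20 b21 b22 b23 b30 b31 b32 b33 ->
  [/\ [/\ a00 = b00, a01 = b01, a02 = b02 & a03 = b03],
      [/\ a10 = b10, a11 = b11, a12 = b12 & a13 = b13],
      [/\ a20 = b20, a21 = b21, a22 = b22 & a23 = b23] &
      [/\ a30 = b30, a31 = b31, a32 = b32 & a33 = b33]].
Proof.
move=> /matrixP E.
by split; split;
 [move: (E (inord 0) (inord 0))|move: (E (inord 0) (inord 1))
 |move: (E (inord 0) (inord 2))|move: (E (inord 0) (inord 3))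
 |move: (E (inord 1) (inord 0))|move: (E (inord 1) (inord 1))
 |move: (E (inord 1) (inord 2))|move: (E (inord 1) (inord 3))
 |move: (E (inord 2) (inord 0))|move: (E (inord 2) (inord 1))
 |move: (E (inord 2) (inord 2))|move: (E (inord 2) (inord 3))
 |move: (E (inord 3) (inord 0))|move: (E (inord 3) (inord 1))
 |move: (E (inord 3) (inord 2))|move: (E (inord 3) (inord 3))];
 rewrite !mxE !inordK.
Qed.

Definition m4E := (m4M, m4D, m4N, m4Z).

(** The Gram matrix of an adapted frame, up to a scalar factor. *)
Definition J4 : 'M[K]_4 := m4 0 0 0 1 0 0 (-1) 0 0 (-1) 0 0 1 0 0 0.

(** The connection matrix in the direction x of the frame made of sigma,
    sigma_x, sigma_y and sigma_xy + e sigma_x + c sigma_y + t sigma; its last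
    column is left as parameters. *)
Definition conn_mx_x c e p t b M P k : 'M[K]_4 :=
  m4 0 p (- t) k
     1 0 (- e) M
     0 b (- c) P
     0 0 1 c.

(** The same in the direction y; the roles of the two middle vectors are
    exchanged. *)
Definition conn_mx_y c e q t g M P k : 'M[K]_4 :=
  m4 0 (- t) q k
     0 (- e) g P
     1 (- c) 0 M
     0 1 0 e.

(** The matrix, in an adapted frame, of an endomorphism in the sum of
    g_{-1} /\ h (the entries u and v) and g_{-2} (the entry w). *)
Definition theta4 u v w : 'M[K]_4 := m4 0 u v w 0 0 0 v 0 0 0 u 0 0 0 0.

(** The J4-symmetric part of conn_mx_x minus the scalar l (symmetric_part_conn_x).
    By nonmetricity_frame, this is the matrix of the non-metricity in the
    direction x. *)
Definition nonmet_x c e b l r s k : 'M[K]_4 :=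
  m4 (c / 2 - l) (- r) (- s) k
     0 (- c / 2 - l) (- e) s
     0 b (- c / 2 - l) r
     0 0 0 (c / 2 - l).

Definition nonmet_y c e g l r s k : 'M[K]_4 :=
  m4 (e / 2 - l) (- s) (- r) k
     0 (- e / 2 - l) g r
     0 (- c) (- e / 2 - l) s
     0 0 0 (e / 2 - l).

Lemma symmetric_part_conn_x c e p t b M P k l :
  2^-1 *: (conn_mx_x c e p t b M P k + J4 *m (conn_mx_x c e p t b M P k)^T *m J4) - l%:M =
  nonmet_x c e b l ((P - p) / 2) ((t + M) / 2) k.
Proof. by rewrite /conn_mx_x /J4 /nonmet_x m4T scalar_m4 !m4E; congr m4; lra. Qed.

Lemma symmetric_part_conn_y c e q t g M P k l :
  2^-1 *: (conn_mx_y c e q t g M P k + J4 *m (conn_mx_y c e q t g M P k)^T *m J4) - l%:M =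
  nonmet_y c e g l ((P - q) / 2) ((t + M) / 2) k.
Proof. by rewrite /conn_mx_y /J4 /nonmet_y m4T scalar_m4 !m4E; congr m4; lra. Qed.

End FourByFour.

(** * The structure equation, entry by entry *)

Section StructureEquation.
Variable R : realType.

(** The left side is the matrix, in an adapted frame, of d theta + [N_x, N_y]
    for theta = chi + psi. The scalars l and l' disappear from the commutator,
    which is why rescaling the metric does not change the equation. *)
Lemma structure_eq (c e t b g p q M M' P P' k k' l l' r r' s s'
    u1 v1 w1 u2 v2 w2 u1y v1y w1y u2x v2x w2x : R) :
  theta4 u2x v2x w2x - theta4 u1y v1y w1y
  + commutator (conn_mx_x c e p t b M P k) (theta4 u2 v2 w2)
  - commutator (conn_mx_y c e q t g M' P' k') (theta4 u1 v1 w1)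
  + commutator (nonmet_x c e b l r s k) (nonmet_y c e g l' r' s' k') =
  let X1 := e * r + c * (s - s') + b * r' in
  let X2 := - g * r + e * (s - s') - c * r' in
  m4 (v1 - u2)
     (u2x - u1y - b * v2 - (c * v1 + e * u1 - w1) + X1)
     (v2x - v1y + (e * u2 + c * v2 - w2) + g * u1 + X2)
     (w2x - w1y + (p * v2 - t * u2 - u2 * M - v2 * P - c * w2) -
       (q * u1 - t * v1 - v1 * M' - u1 * P' - e * w1))
     0 (u2 + v1 + (e * c - b * g)) 0
     (v2x - v1y + w2 - e * u2 - c * v2 - g * u1 + 2 * e * v1 + X2)
     0 0 (- (u2 + v1 + (e * c - b * g)))
     (u2x - u1y + b * v2 - 2 * c * u2 - w1 + c * v1 + e * u1 + X1)
     0 0 0 (u2 - v1).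
Proof.
rewrite /commutator /theta4 /conn_mx_x /conn_mx_y /nonmet_x /nonmet_y !m4E /=.
by congr m4; lra.
Qed.

Lemma zero_m4 : (0 : 'M[R]_4) = m4 0 0 0 0 0 0 0 0 0 0 0 0 0 0 0 0.
Proof. by apply/matrixP; apply: ord4P; apply: ord4P; rewrite !mxE !inordK. Qed.

(** The entries (0, 0) and (1, 1), and the differences of the entries (0, 1)
    and (2, 3) and of the entries (0, 2) and (1, 3), contain no derivatives:
    they express the coefficients v1, u2, w1, w2 of theta by u1 and v2. *)
Lemma structure_eq_algebraic (c e t b g p q M M' P P' k k' l l' r r' s s'
    u1 v1 w1 u2 v2 w2 u1y v1y w1y u2x v2x w2x : R) :
  theta4 u2x v2x w2x - theta4 u1y v1y w1y
  + commutator (conn_mx_x c e p t b M P k) (theta4 u2 v2 w2)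
  - commutator (conn_mx_y c e q t g M' P' k') (theta4 u1 v1 w1)
  + commutator (nonmet_x c e b l r s k) (nonmet_y c e g l' r' s' k') = 0 ->
  [/\ v1 = (b * g - e * c) / 2, u2 = (b * g - e * c) / 2,
      w1 = e * u1 + b * v2 & w2 = c * v2 + g * u1].
Proof.
rewrite structure_eq zero_m4 => /m4_inj /= [[E0 E1 E2 _] [_ E4 _ E5] [_ _ _ E6] _].
have v1E : v1 = u2 by lra.
rewrite v1E in E1 E2 E4 E5 E6 *; have u2E : u2 = (b * g - e * c) / 2 by lra.
by split => //; lra.
Qed.

(** Once the algebraic entries hold, three scalar equations remain. The
    shifted unknowns u1 - (e b - c^2 / 2) / 2 and v2 - (c g - e^2 / 2) / 2
    absorb the parameters c and e of the metric. The names bx, by_, cx and so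
    on stand for the values of the derivatives of b, c and so on. *)
Lemma structure_eq_pde (c e t b g p q k k' l l' cx cy ex ey bx by_ gx gy
    u1 v2 u1x u1y v2x v2y : R) :
  let M := b * g + ex - c * e + t in
  let P := by_ + p + e * b + cx - c * c in
  let M' := b * g + cy - c * e + t in
  let P' := gx + q + c * g + ey - e * e in
  let h := (b * g - e * c) / 2 in
  theta4 ((bx * g + b * gx - (ex * c + e * cx)) / 2) v2x
     ((cx * v2 + c * v2x) + (gx * u1 + g * u1x))
  - theta4 u1y ((by_ * g + b * gy - (ey * c + e * cy)) / 2)
     ((ey * u1 + e * u1y) + (by_ * v2 + b * v2y))
  + commutator (conn_mx_x c e p t b M P k) (theta4 h v2 (c * v2 + g * u1))
  - commutator (conn_mx_y c e q t g M' P' k') (theta4 u1 h (e * u1 + b * v2))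
  + commutator (nonmet_x c e b l ((P - p) / 2) ((t + M) / 2) k)
      (nonmet_y c e g l' ((P' - q) / 2) ((t + M') / 2) k') = 0 <->
  [/\ 2 * by_ * (v2 - (c * g - e * e / 2) / 2)
       + b * (v2y - ((cy * g + c * gy) - (ey * e + e * ey) / 2) / 2) =
      2 * gx * (u1 - (e * b - c * c / 2) / 2)
       + g * (u1x - ((ex * b + e * bx) - (cx * c + c * cx) / 2) / 2),
      2 * (v2x - ((cx * g + c * gx) - (ex * e + e * ex) / 2) / 2)
       = 2 * g * by_ + b * gy
    & 2 * (u1y - ((ey * b + e * by_) - (cy * c + c * cy) / 2) / 2)
       = 2 * b * gx + g * bx].
Proof.
move=> M P M' P' h; rewrite structure_eq zero_m4; split.
  move=> /m4_inj /= [[E0 E1 E2 E3] [_ E4 _ E5] [_ _ _ E6] _].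
  have F1 : u1y = ((ey * b + e * by_) - (cy * c + c * cy) / 2) / 2 +
      b * gx + g * bx / 2.
    by move: E1; rewrite /h /M /P /M' /P'; lra.
  have F2 : v2x = ((cx * g + c * gx) - (ex * e + e * ex) / 2) / 2 +
      g * by_ + b * gy / 2.
    by move: E2; rewrite /h /M /P /M' /P'; lra.
  split; [|by rewrite F2; lra|by rewrite F1; lra].
  by move: E3; rewrite F1 F2 /h /M /P /M' /P'; lra.
case=> H3 H2 H1.
have F1 : u1y = ((ey * b + e * by_) - (cy * c + c * cy) / 2) / 2 +
    b * gx + g * bx / 2 by lra.
have F2 : v2x = ((cx * g + c * gx) - (ex * e + e * ex) / 2) / 2 +
    g * by_ + b * gy / 2 by lra.
rewrite /= F1 F2 /h /M /P /M' /P'.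
by congr m4; lra.
Qed.

End StructureEquation.

(** * Metric connections and their curvature *)

Section MetricLemmas.
Variables (R : realType) (U : set (R * R)).
Hypothesis hU : open U.

Lemma mulmx_cV_inj (m n : nat) (A B : 'M[R]_(m, n)) :
  (forall v : 'cV_n, A *m v = B *m v) -> A = B.
Proof.
move=> AB; apply/matrixP => i j.
by have /matrixP/(_ i 0) := AB (delta_mx j 0); rewrite -!colE !mxE.
Qed.

Lemma bform_delta (G : 'M[R]_4) i j :
  bform G (delta_mx i 0) (delta_mx j 0) = G i j.
Proof. by rewrite /bform trmx_delta -rowE -colE !mxE. Qed.

Lemma bformE (G A B : 'M[R]_4) u v :
  bform G (A *m u) (B *m v) = bform (A^T *m G *m B) u v.
Proof. by rewrite /bform trmx_mul !mulmxA. Qed.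

Lemma bform_mx_inj (G H : 'M[R]_4) :
  (forall u v, bform G u v = bform H u v) -> G = H.
Proof. by move=> GH; apply/matrixP => i j; rewrite -!bform_delta GH. Qed.

Lemma gsymP (G A : 'M[R]_4) : gsym G A <-> A^T *m G = G *m A.
Proof.
split=> [sA|AG u v].
  apply: bform_mx_inj => u v.
  have := sA u v; rewrite -{1}[v]mul1mx -{2}[u]mul1mx !bformE.
  by rewrite trmx1 mul1mx mulmx1.
by rewrite -{1}[v]mul1mx -{2}[u]mul1mx !bformE trmx1 mul1mx mulmx1 AG.
Qed.

Lemma bformN (G : 'M[R]_4) u v : bform (- G) u v = - bform G u v.
Proof. by rewrite /bform mulmxN mulNmx mxE. Qed.

Lemma bformZ (G : 'M[R]_4) (k : R) u v : bform (k *: G) u v = k * bform G u v.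
Proof. by rewrite /bform -scalemxAr -scalemxAl mxE. Qed.

Lemma gskewP (G A : 'M[R]_4) : gskew G A <-> A^T *m G = - (G *m A).
Proof.
split=> [sA|AG u v].
  apply: bform_mx_inj => u v.
  have := sA u v; rewrite -{1}[v]mul1mx -{2}[u]mul1mx !bformE -bformN.
  by rewrite trmx1 mul1mx mulmx1.
by rewrite -{1}[v]mul1mx -{2}[u]mul1mx !bformE -bformN trmx1 mul1mx mulmx1 AG.
Qed.

Section Decomposition.
Variables (g : R * R -> 'M[R]_4) (omega N : form1 R).
Hypothesis hg : is_metric U g.
Hypothesis hdec : metric_decomposition U g omega N.

(** Apply the decomposition d = D^g + N^g to constant sections. *)
Lemma connection_form_opp p X : U p -> omega p X = - N p X.
Proof.
move=> Up; have [_ _ _ dec] := hdec.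
apply/eqP; rewrite -addr_eq0; apply/eqP/mulmx_cV_inj => v.
have := dec (fun=> v) (smooth_cst hU v) p X Up.
rewrite /covd mulmxDl mul0mx.
have -> : 'D_X (fun=> v) p = 0 by exact: derive_cst.
by rewrite add0r => <-.
Qed.

Lemma gsym_nonmetricity p X : U p -> (N p X)^T *m g p = g p *m N p X.
Proof. by move=> Up; have [_ _ [_ _ sN] _] := hdec; exact/gsymP/sN. Qed.

(** Constant sections in D^g g = 0, together with the symmetry of N, give
    d g = - 2 g N. *)
Lemma derive_metric p X : U p -> 'D_X g p = - (2 *: (g p *m N p X)).
Proof.
move=> Up; have [_ mc _ _] := hdec; have [sg _] := hg.
have dg : differentiable g p by exact: smooth_differentiable sg Up.
apply/matrixP => i j; rewrite derive_mxE//.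
have := mc (fun=> delta_mx i 0) (fun=> delta_mx j 0)
  (smooth_cst hU _) (smooth_cst hU _) p X Up.
have -> : (fun q => bform (g q) (delta_mx i 0) (delta_mx j 0)) =
    (fun q => g q i j) by apply/funext => q; rewrite bform_delta.
rewrite /covd.
have -> : 'D_X (fun=> delta_mx i 0 : 'cV[R]_4) p = 0 by exact: derive_cst.
have -> : 'D_X (fun=> delta_mx j 0 : 'cV[R]_4) p = 0 by exact: derive_cst.
rewrite !add0r connection_form_opp// => ->.
rewrite -[X in bform _ _ X + _]mul1mx -[X in _ + bform _ X _]mul1mx !bformE.
rewrite trmx1 mul1mx mulmx1 linearN /= mulNmx mulmxN !bformN !bform_delta.
by rewrite gsym_nonmetricity// !mxE mulr2n mulrDl mul1r opprD.
Qed.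

Lemma smooth_nonmetricity X : smooth U (fun q => N q X).
Proof. by have [_ _ [_ sN _] _] := hdec; exact: sN. Qed.

(** This is d^2 g = 0: differentiate d g = - 2 g N once more, use the
    symmetry of second derivatives and cancel g. It says that the exterior
    covariant derivative of N for D^g vanishes. *)
Lemma ext_d_nonmetricity p X Y : U p ->
  ext_d N p X Y = 2 *: commutator (N p X) (N p Y).
Proof.
move=> Up; have [sg ug] := hg; have [_ ugp] := ug p Up.
have dg : differentiable g p := smooth_differentiable sg Up.
have dN Z : differentiable (fun q => N q Z) p.
  exact: smooth_differentiable (smooth_nonmetricity Z) Up.
have DD Z T : 'D_Z (fun q => 'D_T g q) p =
   - (2 *: (g p *m ('D_Z (fun q => N q T) p - 2 *: (N p Z *m N p T)))).
  transitivity ('D_Z (- (2 *: (fun q => g q *m N q T))) p).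
    by apply: (derive_eqU hU _ _ Up) => q Uq; rewrite derive_metric.
  have dgN : derivable (fun q => g q *m N q T) p Z.
    apply: diff_derivable; apply: smooth_differentiable Up.
    exact: smooth_mulmx (smooth_nonmetricity _).
  rewrite deriveN; last exact: derivableZ.
  rewrite deriveZ// derive_mulmx// derive_metric//.
  congr (- (_ *: _)).
  by rewrite mulmxBr -scalemxAr addrC mulNmx mulmxA -scalemxAl.
have := etrans (esym (DD X Y)) (etrans (derive_comm_mx hU Y X sg Up) (DD Y X)).
move=> /oppr_inj.
have two0 : (2 : R) != 0 by [].
move=> /(scalerI two0)/(congr1 (mulmx (invmx (g p)))).
rewrite !mulKmx// /ext_d /commutator => /eqP; rewrite subr_eq => /eqP ->.
by rewrite scalerBr addrAC [X in X + _]addrAC subrr add0r addrC.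
Qed.

(** Flatness of d = D^g + N splits into a g-symmetric and a g-skew part;
    this is the skew part. *)
Lemma curvature_nonmetricity p X Y : U p ->
  curvature omega p X Y = - commutator (N p X) (N p Y).
Proof.
move=> Up.
have dN Z : derivable (fun q => N q Z) p X /\ derivable (fun q => N q Z) p Y.
  by split; apply: diff_derivable;
     exact: smooth_differentiable (smooth_nonmetricity Z) Up.
have DN Z T : derivable (fun q => N q T) p Z ->
    'D_Z (fun q => omega q T) p = - 'D_Z (fun q => N q T) p.
  move=> dNT; transitivity ('D_Z (- (fun q => N q T)) p); last exact: deriveN.
  by apply: (derive_eqU hU _ _ Up) => q Uq; rewrite connection_form_opp.
rewrite /curvature /ext_d !DN; [|exact: (dN _).2|exact: (dN _).1].
rewrite -opprD /commutator !connection_form_opp// !mulmxN !mulNmx !opprK.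
have := ext_d_nonmetricity X Y Up; rewrite /ext_d /commutator.
move=> ->.
by rewrite scaler_nat mulr2n opprD addrNK.
Qed.

End Decomposition.

Lemma commutator_frame (A B a b F : 'M[R]_4) :
  A *m F = F *m a -> B *m F = F *m b ->
  commutator A B *m F = F *m commutator a b.
Proof.
by move=> EA EB; rewrite /commutator mulmxBl mulmxBr -!mulmxA EB EA !mulmxA EA EB.
Qed.

(** The structure equation of a frame F with d F = F A: conjugation by F turns
    d alpha into d a + [A /\ a]. *)
Lemma frame_ext_d (F : R * R -> 'M[R]_4) (A a : R * R -> R * R -> 'M[R]_4)
    (alpha : form1 R) p X Y :
  smooth U F -> U p ->
  (forall Z, 'D_Z F p = F p *m A Z p) ->
  (forall Z, smooth U (fun q => alpha q Z)) ->
  (forall Z, smooth U (a Z)) ->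
  (forall q Z, U q -> alpha q Z *m F q = F q *m a Z q) ->
  ext_d alpha p X Y *m F p =
  F p *m ('D_X (a Y) p - 'D_Y (a X) p
          + commutator (A X p) (a Y p) - commutator (A Y p) (a X p)).
Proof.
move=> sF Up DF salpha sa alphaF.
have dF := smooth_differentiable sF Up.
have D Z T : 'D_Z (fun q => alpha q T) p *m F p =
    F p *m ('D_Z (a T) p + commutator (A Z p) (a T p)).
  have dalpha := smooth_differentiable (salpha T) Up.
  have da := smooth_differentiable (sa T) Up.
  have := derive_mulmx Z dalpha dF.
  rewrite (derive_eqU hU Z (fun q Uq => alphaF q T Uq) Up).
  rewrite (derive_mulmx Z dF da) DF mulmxA alphaF// => E.
  rewrite /commutator mulmxDr mulmxBr !mulmxA [X in _ + X]addrC.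
  by apply/eqP; rewrite eq_sym addrCA addrC subr_eq -E addrC.
by rewrite /ext_d mulmxBl !D -mulmxBr opprD addrACA addrA.
Qed.

End MetricLemmas.

(** * Frames as matrices of columns *)

Section Columns.
Variable R : realType.
Implicit Types a b c d : 'cV[R]_4.

Definition cols4 a b c d : 'M[R]_4 :=
  \matrix_(i < 4, j < 4) nth 0 [:: a; b; c; d] j i 0.

Lemma mul_cols4 (A : 'M[R]_4) a b c d :
  A *m cols4 a b c d = cols4 (A *m a) (A *m b) (A *m c) (A *m d).
Proof.
by apply/matrixP => i; apply: ord4P; rewrite mxE [RHS]mxE inordK//= mxE;
  apply: eq_bigr => k _; rewrite !mxE !inordK.
Qed.

Lemma cols4_mulv a b c d (y : 'cV[R]_4) :
  cols4 a b c d *m y = y (inord 0) 0 *: a + y (inord 1) 0 *: b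
                       + y (inord 2) 0 *: c + y (inord 3) 0 *: d.
Proof.
apply/matrixP => i j; rewrite ord1 !mxE sum4 !mxE !inordK//=.
by congr (_ + _ + _ + _); exact: mulrC.
Qed.

Lemma cols4_m4 a b c d (a00 a01 a02 a03 a10 a11 a12 a13
    a20 a21 a22 a23 a30 a31 a32 a33 : R) :
  cols4 a b c d *m m4 a00 a01 a02 a03 a10 a11 a12 a13
                      a20 a21 a22 a23 a30 a31 a32 a33 =
  cols4 (a00 *: a + a10 *: b + a20 *: c + a30 *: d)
        (a01 *: a + a11 *: b + a21 *: c + a31 *: d)
        (a02 *: a + a12 *: b + a22 *: c + a32 *: d)
        (a03 *: a + a13 *: b + a23 *: c + a33 *: d).
Proof.
by apply/matrixP => i; apply: ord4P; rewrite !mxE sum4 !mxE !inordK//= !mxE;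
  congr (_ + _ + _ + _); exact: mulrC.
Qed.

Lemma cols4_inj a b c d a' b' c' d' : cols4 a b c d = cols4 a' b' c' d' ->
  [/\ a = a', b = b', c = c' & d = d'].
Proof.
move=> /matrixP E; split; apply/matrixP => i j; rewrite ord1;
 [have := E i (inord 0)|have := E i (inord 1)
 |have := E i (inord 2)|have := E i (inord 3)]; by rewrite !mxE !inordK.
Qed.

Lemma gram_cols4 (G : 'M[R]_4) a b c d :
  (cols4 a b c d)^T *m G *m cols4 a b c d =
  m4 (bform G a a) (bform G a b) (bform G a c) (bform G a d)
     (bform G b a) (bform G b b) (bform G b c) (bform G b d)
     (bform G c a) (bform G c b) (bform G c c) (bform G c d)
     (bform G d a) (bform G d b) (bform G d c) (bform G d d).
Proof.
have E i j : ((cols4 a b c d)^T *m G *m cols4 a b c d) i j =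
   bform G (nth 0 [:: a; b; c; d] i) (nth 0 [:: a; b; c; d] j).
  rewrite -bform_delta /bform trmx_delta !mulmxA -rowE.
  rewrite -!mulmxA -colE !mulmxA; congr ((_ *m _ *m _) _ _).
    by apply/matrixP => k l; rewrite !mxE ord1.
  by apply/matrixP => k l; rewrite !mxE ord1.
by apply/matrixP; apply: ord4P; apply: ord4P; rewrite E [RHS]mxE !inordK.
Qed.

(** A row vector in the kernel of the transpose is a linear relation between
    the columns. *)
Lemma unitmx_cols4 a b c d : free [:: a; b; c; d] -> cols4 a b c d \in unitmx.
Proof.
move=> fr; rewrite -unitmx_tr unitmxE unitfE; apply/negP => /det0P[v v0].
move=> /(congr1 trmx); rewrite trmx_mul trmxK trmx0 cols4_mulv => E.
have /(freeP (X := [tuple a; b; c; d])) := fr.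
move=> /(_ (fun i => v^T i 0)); rewrite sum4 /= !inordK//= => /(_ E) vE.
move/eqP: v0; apply; apply/matrixP => i j; rewrite ord1.
by have := vE j; rewrite !mxE.
Qed.

Section ColumnFunctions.
Variable U : set (R * R).
Hypothesis hU : open U.

Lemma smooth_cols4 (a b c d : R * R -> 'cV[R]_4) :
  smooth U a -> smooth U b -> smooth U c -> smooth U d ->
  smooth U (fun p => cols4 (a p) (b p) (c p) (d p)).
Proof.
move=> /(smooth_mxP hU) sa /(smooth_mxP hU) sb /(smooth_mxP hU) sc
  /(smooth_mxP hU) sd.
apply/smooth_mxP => // i; apply: ord4P;
  [apply: (smooth_eqU hU _ (sa i 0))|apply: (smooth_eqU hU _ (sb i 0))
  |apply: (smooth_eqU hU _ (sc i 0))|apply: (smooth_eqU hU _ (sd i 0))];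
  by move=> p _; rewrite !mxE !inordK.
Qed.

Lemma derive_cols4 (a b c d : R * R -> 'cV[R]_4) X p :
  smooth U a -> smooth U b -> smooth U c -> smooth U d -> U p ->
  'D_X (fun q => cols4 (a q) (b q) (c q) (d q)) p =
  cols4 ('D_X a p) ('D_X b p) ('D_X c p) ('D_X d p).
Proof.
move=> sa sb sc sd Up.
have da := smooth_differentiable sa Up; have db := smooth_differentiable sb Up.
have dc := smooth_differentiable sc Up; have dd := smooth_differentiable sd Up.
have dF := smooth_differentiable (smooth_cols4 sa sb sc sd) Up.
apply/matrixP => i j; rewrite (derive_mxE _ _ _ dF) mxE; move: j; apply: ord4P;
  rewrite inordK//=; [rewrite (derive_mxE _ _ _ da)|rewrite (derive_mxE _ _ _ db)
    |rewrite (derive_mxE _ _ _ dc)|rewrite (derive_mxE _ _ _ dd)];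
  by apply: (derive_eqU hU _ _ Up) => q _; rewrite !mxE inordK.
Qed.

Lemma derive_scalemx (f : R * R -> R) m n (M : R * R -> 'M[R]_(m, n)) X p :
  smooth U f -> smooth U M -> U p ->
  'D_X (fun q => f q *: M q) p = 'D_X f p *: M p + f p *: 'D_X M p.
Proof.
move=> sf sM Up; have dM := smooth_differentiable sM Up.
have dfM := smooth_differentiable (smooth_scalemx hU sf sM) Up.
apply/matrixP => i j; rewrite (derive_mxE _ _ _ dfM) !mxE (derive_mxE _ _ _ dM).
transitivity ('D_X (fun q => f q * M q i j) p).
  by apply: (derive_eqU hU _ _ Up) => q _; rewrite mxE.
apply: derivefM; first exact: smooth_differentiable sf Up.
by have /differentiable_mxP := dM; exact.
Qed.

Lemma derive_addmx m n (M P : R * R -> 'M[R]_(m, n)) X p :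
  smooth U M -> smooth U P -> U p ->
  'D_X (fun q => M q + P q) p = 'D_X M p + 'D_X P p.
Proof.
move=> sM sP Up; apply: (@deriveD _ _ _ M P); apply: diff_derivable.
  exact: smooth_differentiable sM Up.
exact: smooth_differentiable sP Up.
Qed.

End ColumnFunctions.
End Columns.

(** * The frame equations of the surface *)

Section SurfaceFrame.
Variables (R : realType) (U : set (R * R)).
Hypothesis hU : open U.
Variable sigma : R * R -> 'cV[R]_4.
Hypothesis ssigma : smooth U sigma.
Variables beta gamma V W : R * R -> R.
Hypothesis hbeta : smooth U beta.
Hypothesis hgamma : smooth U gamma.
Hypothesis hV : smooth U V.
Hypothesis hW : smooth U W.
Hypothesis hxx : forall p, U p ->
     pdx (pdx sigma) p =
       beta p *: pdy sigma p + (2^-1 * (V p - pdy beta p)) *: sigma p.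
Hypothesis hyy : forall p, U p ->
     pdy (pdy sigma) p =
       gamma p *: pdx sigma p + (2^-1 * (W p - pdx gamma p)) *: sigma p.
Hypothesis hfree : forall p, U p ->
     free [:: sigma p; pdx sigma p; pdy sigma p; pdy (pdx sigma) p].

Let s1 := pdx sigma.
Let s2 := pdy sigma.
Let s3 := pdy (pdx sigma).

Definition coefp (q : R * R) : R := 2^-1 * (V q - pdy beta q).
Definition coefq (q : R * R) : R := 2^-1 * (W q - pdx gamma q).

Lemma smooth_pdx (T : normedModType R) (f : R * R -> T) :
  smooth U f -> smooth U (pdx f).
Proof. exact: smooth_derive. Qed.

Lemma smooth_pdy (T : normedModType R) (f : R * R -> T) :
  smooth U f -> smooth U (pdy f).
Proof. exact: smooth_derive. Qed.

Lemma smooth_coefp : smooth U coefp.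
Proof.
apply: smoothM => //; first exact: smooth_cst.
by apply: smoothB => //; exact: smooth_pdy.
Qed.

Lemma smooth_coefq : smooth U coefq.
Proof.
apply: smoothM => //; first exact: smooth_cst.
by apply: smoothB => //; exact: smooth_pdx.
Qed.

Let ss1 : smooth U s1 := smooth_pdx ssigma.
Let ss2 : smooth U s2 := smooth_pdy ssigma.
Let ss3 : smooth U s3 := smooth_pdy (smooth_pdx ssigma).

Lemma pdx_s2 p : U p -> pdx s2 p = s3 p.
Proof. by move=> Up; exact: (derive_comm_mx hU (0, 1) (1, 0) ssigma Up). Qed.

(** Commute the derivatives and differentiate the equation for sigma_xx along
    y. *)
Lemma pdx_s3 p : U p -> pdx s3 p =
  (beta p * coefq p + pdy coefp p) *: sigma p + (beta p * gamma p) *: s1 p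
  + (pdy beta p + coefp p) *: s2 p.
Proof.
move=> Up.
apply: etrans (derive_comm_mx hU (0, 1) (1, 0) ss1 Up) _.
have E q : U q -> 'D_((1, 0) : R * R) s1 q = beta q *: s2 q + coefp q *: sigma q.
  exact: hxx.
apply: etrans (derive_eqU hU (0, 1) E Up) _.
rewrite (derive_addmx (0, 1) (smooth_scalemx hU hbeta ss2)
  (smooth_scalemx hU smooth_coefp ssigma) Up).
rewrite (derive_scalemx hU (0, 1) hbeta ss2 Up).
rewrite (derive_scalemx hU (0, 1) smooth_coefp ssigma Up).
have -> : 'D_(0, 1) s2 p = gamma p *: s1 p + coefq p *: sigma p by exact: hyy.
rewrite -/(pdy beta p) -/(pdy coefp p) -/(pdy sigma p) -/(s2 p).
move: (pdy beta p) (pdy coefp p) (beta p) (gamma p) (coefp p) (coefq p).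
move: (sigma p) (s1 p) (s2 p) => v0 v1 v2 b' p' b g p0 q0.
by apply/matrixP => i j; rewrite !mxE; ring.
Qed.

(** Commute the derivatives twice and differentiate the equation for sigma_yy
    along x. *)
Lemma pdy_s3 p : U p -> pdy s3 p =
  (gamma p * coefp p + pdx coefq p) *: sigma p + (pdx gamma p + coefq p) *: s1 p
  + (beta p * gamma p) *: s2 p.
Proof.
move=> Up.
have E1 q : U q -> s3 q = pdx s2 q by move=> Uq; rewrite pdx_s2.
apply: etrans (derive_eqU hU (0, 1) E1 Up) _.
apply: etrans (derive_comm_mx hU (1, 0) (0, 1) ss2 Up) _.
have E q : U q -> 'D_((0, 1) : R * R) s2 q = gamma q *: s1 q + coefq q *: sigma q.
  exact: hyy.
apply: etrans (derive_eqU hU (1, 0) E Up) _.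
rewrite (derive_addmx (1, 0) (smooth_scalemx hU hgamma ss1)
  (smooth_scalemx hU smooth_coefq ssigma) Up).
rewrite (derive_scalemx hU (1, 0) hgamma ss1 Up).
rewrite (derive_scalemx hU (1, 0) smooth_coefq ssigma Up).
have -> : 'D_(1, 0) s1 p = beta p *: s2 p + coefp p *: sigma p by exact: hxx.
rewrite -/(pdx gamma p) -/(pdx coefq p) -/(pdx sigma p) -/(s1 p).
move: (pdx gamma p) (pdx coefq p) (beta p) (gamma p) (coefp p) (coefq p).
move: (sigma p) (s1 p) (s2 p) => v0 v1 v2 g' q' b g p0 q0.
by apply/matrixP => i j; rewrite !mxE; ring.
Qed.

Section AdaptedFrame.
Variables c e t : R * R -> R.
Hypothesis sc : smooth U c.
Hypothesis se : smooth U e.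
Hypothesis st : smooth U t.

(** The parameters c, e, t are chosen in exists_adapted_frame so that an
    enveloped metric takes its normal form in this frame. *)
Definition last_vec (p : R * R) : 'cV[R]_4 :=
  s3 p + (e p *: s1 p + (c p *: s2 p + t p *: sigma p)).

Definition frame (p : R * R) : 'M[R]_4 := cols4 (sigma p) (s1 p) (s2 p) (last_vec p).

Let sts := smooth_scalemx hU st ssigma.
Let scs2 := smooth_scalemx hU sc ss2.
Let ses1 := smooth_scalemx hU se ss1.

Lemma smooth_last_vec : smooth U last_vec.
Proof. exact (smooth_addmx hU ss3 (smooth_addmx hU ses1 (smooth_addmx hU scs2 sts))). Qed.

Lemma smooth_frame : smooth U frame.
Proof. exact (smooth_cols4 hU ssigma ss1 ss2 smooth_last_vec). Qed.

Lemma derive_last_vec X p : U p -> 'D_X last_vec p =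
  'D_X s3 p + (('D_X e p *: s1 p + e p *: 'D_X s1 p)
   + (('D_X c p *: s2 p + c p *: 'D_X s2 p)
   + ('D_X t p *: sigma p + t p *: 'D_X sigma p))).
Proof.
move=> Up.
have sum_eq (v a b a' b' d d' : 'cV[R]_4) :
  a = a' -> b = b' -> d = d' -> v + (a + (b + d)) = v + (a' + (b' + d')).
  by move=> -> -> ->.
have E3 := derive_addmx X scs2 sts Up.
have E2 := derive_addmx X ses1 (smooth_addmx hU scs2 sts) Up.
rewrite E3 in E2.
have E1 := derive_addmx X ss3 (smooth_addmx hU ses1 (smooth_addmx hU scs2 sts)) Up.
rewrite E2 in E1.
exact (etrans E1 (sum_eq _ _ _ _ _ _ _ (derive_scalemx hU X se ss1 Up)
  (derive_scalemx hU X sc ss2 Up) (derive_scalemx hU X st ssigma Up))).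
Qed.

Lemma derive_frame X p a0 a1 a2 a3 : U p ->
  'D_X sigma p = a0 -> 'D_X s1 p = a1 -> 'D_X s2 p = a2 -> 'D_X s3 p = a3 ->
  'D_X frame p = cols4 a0 a1 a2
    (a3 + (('D_X e p *: s1 p + e p *: a1) + (('D_X c p *: s2 p + c p *: a2)
     + ('D_X t p *: sigma p + t p *: a0)))).
Proof.
move=> Up <- <- <- <-; rewrite -derive_last_vec//.
exact (derive_cols4 hU X ssigma ss1 ss2 smooth_last_vec Up).
Qed.

(** The entries of the last columns of the two connection matrices, that is
    the coordinates of the derivatives of last_vec. *)
Definition Mx p := beta p * gamma p + pdx e p - c p * e p + t p.
Definition Px p := pdy beta p + coefp p + e p * beta p + pdx c p - c p * c p.
Definition Kx p :=
  beta p * coefq p + pdy coefp p + e p * coefp p + pdx t p - c p * t p.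
Definition My p := beta p * gamma p + pdy c p - c p * e p + t p.
Definition Py p := pdx gamma p + coefq p + c p * gamma p + pdy e p - e p * e p.
Definition Ky p :=
  gamma p * coefp p + pdx coefq p + c p * coefq p + pdy t p - e p * t p.

Definition connx p :=
  conn_mx_x (c p) (e p) (coefp p) (t p) (beta p) (Mx p) (Px p) (Kx p).
Definition conny p :=
  conn_mx_y (c p) (e p) (coefq p) (t p) (gamma p) (My p) (Py p) (Ky p).

Lemma pdx_frame p : U p -> pdx frame p = frame p *m connx p.
Proof.
move=> Up; rewrite /pdx.
rewrite (derive_frame Up erefl (hxx Up) (pdx_s2 Up) (pdx_s3 Up)) cols4_m4.
rewrite -/(coefp p) -/(s2 p).
rewrite -/(pdx e p) -/(pdx c p) -/(pdx t p) -/(pdx sigma p) -/(s1 p).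
rewrite /last_vec /Mx /Px /Kx.
move: (pdy beta p) (pdy coefp p) (pdx c p) (pdx e p) (pdx t p).
move: (beta p) (gamma p) (coefp p) (coefq p) (c p) (e p) (t p).
move: (sigma p) (s1 p) (s2 p) (s3 p) => *.
by congr cols4; apply/matrixP => i j; rewrite !mxE; ring.
Qed.

Lemma pdy_frame p : U p -> pdy frame p = frame p *m conny p.
Proof.
move=> Up; rewrite /pdy.
rewrite (derive_frame Up erefl (erefl (s3 p)) (hyy Up) (pdy_s3 Up)) cols4_m4.
rewrite -/(coefq p) -/(s1 p).
rewrite -/(pdy e p) -/(pdy c p) -/(pdy t p) -/(pdy sigma p) -/(s2 p).
rewrite /last_vec /My /Py /Ky.
move: (pdx gamma p) (pdx coefq p) (pdy c p) (pdy e p) (pdy t p).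
move: (beta p) (gamma p) (coefp p) (coefq p) (c p) (e p) (t p).
move: (sigma p) (s1 p) (s2 p) (s3 p) => *.
by congr cols4; apply/matrixP => i j; rewrite !mxE; ring.
Qed.

(** The adapted frame differs from the coordinate frame by a unipotent
    matrix. *)
Lemma unitmx_frame p : U p -> frame p \in unitmx.
Proof.
move=> Up.
have -> : frame p = cols4 (sigma p) (s1 p) (s2 p) (s3 p) *m
    m4 1 0 0 (t p) 0 1 0 (e p) 0 0 1 (c p) 0 0 0 1.
  rewrite cols4_m4 /frame /last_vec.
  move: (sigma p) (s1 p) (s2 p) (s3 p) (c p) (e p) (t p) => *.
  by congr cols4; apply/matrixP => i j; rewrite !mxE; ring.
rewrite unitmx_mul unitmx_cols4; last exact: hfree.
have : m4 1 0 0 (t p) 0 1 0 (e p) 0 0 1 (c p) 0 0 0 1 *m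
    m4 1 0 0 (- t p) 0 1 0 (- e p) 0 0 1 (- c p) 0 0 0 1 = 1%:M.
  by rewrite m4M scalar_m4; move: (c p) (e p) (t p) => *; congr m4; ring.
by case/mulmx1_unit.
Qed.

End AdaptedFrame.
End SurfaceFrame.

(** * Metrics enveloped by a contact lift *)

Section Bform.
Variable R : realType.
Implicit Types (G : 'M[R]_4) (u v w : 'cV[R]_4).

Lemma bformDl G u v w : bform G (u + v) w = bform G u w + bform G v w.
Proof. by rewrite /bform linearD /= !mulmxDl mxE. Qed.

Lemma bformDr G u v w : bform G u (v + w) = bform G u v + bform G u w.
Proof. by rewrite /bform mulmxDr mxE. Qed.

Lemma bformZl G (k : R) u v : bform G (k *: u) v = k * bform G u v.
Proof. by rewrite /bform linearZ /= -!scalemxAl mxE. Qed.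

Lemma bformZr G (k : R) u v : bform G u (k *: v) = k * bform G u v.
Proof. by rewrite /bform -scalemxAr mxE. Qed.

Lemma bformNl G u v : bform G (- u) v = - bform G u v.
Proof. by rewrite -scaleN1r bformZl mulN1r. Qed.

Lemma bformNr G u v : bform G u (- v) = - bform G u v.
Proof. by rewrite -scaleN1r bformZr mulN1r. Qed.

Lemma bformC G u v : G^T = G -> bform G u v = bform G v u.
Proof.
move=> GT; have E : (u^T *m G *m v)^T = v^T *m G *m u.
  by rewrite !trmx_mul trmxK GT mulmxA.
by rewrite /bform -E [RHS]mxE.
Qed.

Lemma smooth_bform (U : set (R * R)) (g : R * R -> 'M[R]_4)
    (s t : R * R -> 'cV[R]_4) : open U ->
  smooth U g -> smooth U s -> smooth U t ->
  smooth U (fun p => bform (g p) (s p) (t p)).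
Proof.
move=> hU sg ss st.
have := smooth_mulmx hU (smooth_mulmx hU (smooth_trmx hU ss) sg) st.
by move=> /(smooth_mxP hU)/(_ ord0 ord0).
Qed.

End Bform.

Section Envelope.
Variables (R : realType) (U : set (R * R)).
Hypothesis hU : open U.
Variables (L : R * R -> set 'cV[R]_4) (sigma : R * R -> 'cV[R]_4).
Hypothesis hsigma : is_lift U L sigma.

Let ssigma : smooth U sigma.
Proof. by case: hsigma. Qed.

Lemma E1P p v : U p -> E1 L p v <-> exists k : R, v = k *: sigma p.
Proof. by move=> Up; rewrite /E1; have [_ /(_ p Up)[_ ->]] := hsigma. Qed.

Lemma bundle_section_sigma : bundle_section U L sigma.
Proof.
split=> // p Up; have [_ /(_ p Up)[_ ->]] := hsigma.
by exists 1; rewrite scale1r.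
Qed.

Lemma linspan_gen (S : set 'cV[R]_4) v : S v -> linspan S v.
Proof.
move=> Sv; exists 1%N, (fun=> 1), (fun=> v); split => //.
by rewrite big_ord1 scale1r.
Qed.

Lemma E2_sigma p : E2 U L p (sigma p).
Proof.
apply: linspan_gen; exists sigma; first exact: bundle_section_sigma.
by left.
Qed.

Lemma E2_derive p X : E2 U L p ('D_X sigma p).
Proof.
apply: linspan_gen; exists sigma; first exact: bundle_section_sigma.
by right; exists X.
Qed.

Section EnvelopedMetric.
Variables (g : R * R -> 'M[R]_4) (omega N : form1 R).
Hypothesis hg : is_metric U g.
Hypothesis hdec : metric_decomposition U g omega N.
Hypothesis henv : envelopes U L g N.

(** The envelope condition, read on the line subbundle. *)
Lemma nonmetricity_sigma p X : U p ->
  exists k : R, N p X *m sigma p = k *: sigma p.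
Proof.
move=> Up; have [_ /(_ p X Up)[N1 _]] := henv.
by apply/(E1P _ Up)/N1/(E1P _ Up); exists 1; rewrite scale1r.
Qed.

Lemma bform_sigma p : U p -> bform (g p) (sigma p) (sigma p) = 0.
Proof.
move=> Up; have [null _] := henv.
by apply: null => //; apply/(E1P _ Up); exists 1; rewrite scale1r.
Qed.

Lemma metric_leibniz (s t : R * R -> 'cV[R]_4) p X :
  smooth U s -> smooth U t -> U p ->
  'D_X (fun q => bform (g q) (s q) (t q)) p =
  bform (g p) ('D_X s p - N p X *m s p) (t p)
  + bform (g p) (s p) ('D_X t p - N p X *m t p).
Proof.
move=> ss st Up; have [_ mc _ _] := hdec; rewrite mc//.
by rewrite /covd (connection_form_opp hU hdec)// !mulNmx.
Qed.

(** Differentiate g(sigma, sigma) = 0: the terms in N vanish because N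
    preserves the null line spanned by sigma. *)
Lemma bform_derive_sigma p X : U p -> bform (g p) ('D_X sigma p) (sigma p) = 0.
Proof.
move=> Up; have [_ /(_ p Up)[gT _]] := hg.
have := metric_leibniz X ssigma ssigma Up.
have -> : 'D_X (fun q => bform (g q) (sigma q) (sigma q)) p = 0.
  by rewrite (derive_eqU hU X bform_sigma Up); exact: derive_cst.
have [k ->] := nonmetricity_sigma X Up.
rewrite bformDl bformDr -scaleNr bformZl bformZr bform_sigma// mulr0 !addr0.
by rewrite (bformC (sigma p))// => /esym/eqP; rewrite -mulr2n mulrn_eq0 => /eqP.
Qed.

(** Differentiate bform_derive_sigma once more; N drops out again since it is
    g-symmetric and preserves the line spanned by sigma. *)
Lemma bform_derive2_sigma p X Y : U p ->
  bform (g p) ('D_Y (fun q => 'D_X sigma q) p) (sigma p)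
  = - bform (g p) ('D_X sigma p) ('D_Y sigma p).
Proof.
move=> Up; have [_ /(_ p Up)[gT _]] := hg.
have sDX := smooth_derive X ssigma.
have := metric_leibniz Y sDX ssigma Up.
have -> : 'D_Y (fun q => bform (g q) ('D_X sigma q) (sigma q)) p = 0.
  have E q : U q -> bform (g q) ('D_X sigma q) (sigma q) = 0.
    exact: bform_derive_sigma.
  by rewrite (derive_eqU hU Y E Up); exact: derive_cst.
have [k Nk] := nonmetricity_sigma Y Up.
have NX : bform (g p) (N p Y *m 'D_X sigma p) (sigma p) = 0.
  rewrite -[X in bform _ _ X]mul1mx bformE mulmx1 (gsym_nonmetricity hdec)//.
  rewrite -[_ *m N p Y]mul1mx -trmx1 mulmxA -bformE mul1mx Nk bformZr.
  by rewrite bform_derive_sigma// mulr0.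
rewrite bformDl bformNl NX oppr0 addr0 Nk bformDr bformNr bformZr.
rewrite bform_derive_sigma// mulr0 oppr0 addr0 => /esym/eqP.
by rewrite addr_eq0 => /eqP.
Qed.

End EnvelopedMetric.
End Envelope.

(** * Adapted frames of an enveloped metric *)

Lemma m4_null_frame (R : realFieldType) (T : Type) (b : T -> T -> R) (v0 v1 v2 v3 : T) :
  (forall u v, b u v = b v u) ->
  b v0 v0 = 0 -> b v1 v0 = 0 -> b v2 v0 = 0 -> b v1 v1 = 0 -> b v2 v2 = 0 ->
  b v1 v2 = - b v0 v3 ->
  m4 (b v0 v0) (b v0 v1) (b v0 v2) (b v0 v3) (b v1 v0) (b v1 v1) (b v1 v2) (b v1 v3)
     (b v2 v0) (b v2 v1) (b v2 v2) (b v2 v3) (b v3 v0) (b v3 v1) (b v3 v2) (b v3 v3) =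
  m4 0 0 0 (b v0 v3) 0 0 (- b v0 v3) (b v1 v3) 0 (- b v0 v3) 0 (b v2 v3)
     (b v0 v3) (b v1 v3) (b v2 v3) (b v3 v3).
Proof.
move=> bC b00 b10 b20 b11 b22 b12.
rewrite (bC v0 v1) (bC v0 v2) (bC v2 v1) (bC v3 v0) (bC v3 v1) (bC v3 v2).
by rewrite b00 b10 b20 b11 b22 b12.
Qed.

Lemma adapted_gram (R : realFieldType) (f b13 b23 b33 c e h : R) :
  c * f = b13 -> e * f = b23 -> h * f = b33 ->
  let t := - (h * 2^-1 + c * e) in
  let T := m4 1 0 0 t 0 1 0 e 0 0 1 c 0 0 0 1 in
  T^T *m (m4 0 0 0 f 0 0 (- f) b13 0 (- f) 0 b23 f b13 b23 b33 *m T) = f *: J4 R.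
Proof.
move=> <- <- <- t T; rewrite /T m4T /J4 !m4E /t.
by congr m4; lra.
Qed.

Section AdaptedGram.
Variables (R : realType) (U : set (R * R)).
Hypothesis hU : open U.
Variables (L : R * R -> set 'cV[R]_4) (sigma : R * R -> 'cV[R]_4).
Hypothesis hsigma : is_lift U L sigma.
Variables beta gamma V W : R * R -> R.
Hypothesis hxx : forall p, U p ->
     pdx (pdx sigma) p =
       beta p *: pdy sigma p + (2^-1 * (V p - pdy beta p)) *: sigma p.
Hypothesis hyy : forall p, U p ->
     pdy (pdy sigma) p =
       gamma p *: pdx sigma p + (2^-1 * (W p - pdx gamma p)) *: sigma p.
Hypothesis hfree : forall p, U p ->
     free [:: sigma p; pdx sigma p; pdy sigma p; pdy (pdx sigma) p].
Variables (g : R * R -> 'M[R]_4) (omega N : form1 R).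
Hypothesis hg : is_metric U g.
Hypothesis hdec : metric_decomposition U g omega N.
Hypothesis henv : envelopes U L g N.

Let s1 := pdx sigma.
Let s2 := pdy sigma.
Let s3 := pdy (pdx sigma).

Let ssigma : smooth U sigma.
Proof. by case: hsigma. Qed.

(** bform_derive2_sigma with (x, x) and (y, y) shows that sigma_x and sigma_y
    are null, because sigma_xx and sigma_yy lie in the g-orthogonal of sigma;
    with (x, y) it relates g(sigma_x, sigma_y) to g(sigma, sigma_xy). *)
Lemma gram_frame0 p : U p ->
  let b := bform (g p) in
  let f := b (sigma p) (s3 p) in
  (cols4 (sigma p) (s1 p) (s2 p) (s3 p))^T *m g p *m
   cols4 (sigma p) (s1 p) (s2 p) (s3 p) =
  m4 0 0 0 f
     0 0 (- f) (b (s1 p) (s3 p))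
     0 (- f) 0 (b (s2 p) (s3 p))
     f (b (s1 p) (s3 p)) (b (s2 p) (s3 p)) (b (s3 p) (s3 p)).
Proof.
move=> Up b f; have [_ /(_ p Up)[gT _]] := hg.
have bC u v : b u v = b v u by exact: bformC.
have b00 : b (sigma p) (sigma p) = 0 := bform_sigma hsigma henv Up.
have b10 : b (s1 p) (sigma p) = 0 :=
  bform_derive_sigma hU hsigma hg hdec henv (1, 0) Up.
have b20 : b (s2 p) (sigma p) = 0 :=
  bform_derive_sigma hU hsigma hg hdec henv (0, 1) Up.
have b11 : b (s1 p) (s1 p) = 0.
  apply: oppr_inj; rewrite oppr0.
  apply: etrans (esym (bform_derive2_sigma hU hsigma hg hdec henv (1, 0) (1, 0) Up)) _.
  have -> : 'D_(1, 0) (fun q => 'D_(1, 0) sigma q) p = _ := hxx Up.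
  by rewrite bformDl !bformZl -/(b (sigma p) (sigma p)) b00
    -/(b (s2 p) (sigma p)) b20 !mulr0 addr0.
have b22 : b (s2 p) (s2 p) = 0.
  apply: oppr_inj; rewrite oppr0.
  apply: etrans (esym (bform_derive2_sigma hU hsigma hg hdec henv (0, 1) (0, 1) Up)) _.
  have -> : 'D_(0, 1) (fun q => 'D_(0, 1) sigma q) p = _ := hyy Up.
  by rewrite bformDl !bformZl -/(b (sigma p) (sigma p)) b00
    -/(b (s1 p) (sigma p)) b10 !mulr0 addr0.
have b12 : b (s1 p) (s2 p) = - f.
  apply: oppr_inj; rewrite opprK /f (bC (sigma p)).
  exact (esym (bform_derive2_sigma hU hsigma hg hdec henv (1, 0) (0, 1) Up)).
rewrite gram_cols4; exact: (m4_null_frame bC b00 b10 b20 b11 b22 b12).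
Qed.

(** Otherwise the first row of the Gram matrix of a basis would vanish. *)
Lemma bform_sigma_s3_neq0 p : U p -> bform (g p) (sigma p) (s3 p) != 0.
Proof.
move=> Up; have [_ /(_ p Up)[_ ug]] := hg.
have uF : cols4 (sigma p) (s1 p) (s2 p) (s3 p) \in unitmx.
  exact/unitmx_cols4/hfree.
apply/eqP => f0; have := gram_frame0 Up; rewrite /= f0.
set H := m4 _ _ _ _ _ _ _ _ _ _ _ _ _ _ _ _ => E.
have uH : H \in unitmx by rewrite -E !unitmx_mul unitmx_tr uF ug.
have r0 : row (inord 0) H = 0.
  by apply/matrixP => i; apply: ord4P; rewrite !mxE !inordK.
have /(congr1 (fun M => M *m invmx H)) := rowE (inord 0) H.
rewrite r0 mul0mx mulmxK// => /matrixP/(_ 0 (inord 0))/eqP.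
by rewrite !mxE !eqxx eq_sym oner_eq0.
Qed.

(** Besides the factor f, the Gram matrix of gram_frame0 has three free
    entries, which a change of the last vector alone removes. *)
Lemma exists_adapted_frame :
  exists f c e t : R * R -> R,
  [/\ smooth U f, smooth U c, smooth U e, smooth U t
    & forall p, U p -> f p != 0 /\
      (frame sigma c e t p)^T *m g p *m frame sigma c e t p = f p *: J4 R].
Proof.
have [sg _] := hg.
have ss1 : smooth U s1 := smooth_derive (1, 0) ssigma.
have ss2 : smooth U s2 := smooth_derive (0, 1) ssigma.
have ss3 : smooth U s3 := smooth_derive (0, 1) ss1.
pose f p := bform (g p) (sigma p) (s3 p).
pose c p := bform (g p) (s1 p) (s3 p) * (f p)^-1.
pose e p := bform (g p) (s2 p) (s3 p) * (f p)^-1.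
pose h p := bform (g p) (s3 p) (s3 p) * (f p)^-1.
(* The value of t makes the last vector of the frame null. *)
pose t p := - (h p * 2^-1 + c p * e p).
have f0 p : U p -> f p != 0 by exact: bform_sigma_s3_neq0.
have sf : smooth U f by exact: smooth_bform.
have sfV : smooth U (fun p => (f p)^-1) by exact: smoothV.
have sc : smooth U c by apply: smoothM => //; exact: smooth_bform.
have se : smooth U e by apply: smoothM => //; exact: smooth_bform.
have sh : smooth U h by apply: smoothM => //; exact: smooth_bform.
have st : smooth U t.
  apply: smoothN => //; apply: smoothD => //; apply: smoothM => //.
  exact: smooth_cst.
exists f, c, e, t; split => // p Up; split; first exact: f0.
have -> : frame sigma c e t p = cols4 (sigma p) (s1 p) (s2 p) (s3 p) *m
    m4 1 0 0 (t p) 0 1 0 (e p) 0 0 1 (c p) 0 0 0 1.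
  rewrite cols4_m4 /frame /last_vec.
  rewrite -/(s1 p) -/(s2 p) -/(s3 p).
  move: (sigma p) (s1 p) (s2 p) (s3 p) (c p) (e p) (t p) => *.
  by congr cols4; apply/matrixP => i j; rewrite !mxE; ring.
rewrite trmx_mul -!mulmxA (mulmxA (cols4 _ _ _ _)^T) (mulmxA _ (cols4 _ _ _ _)).
rewrite gram_frame0//.
have cf k : k / f p * f p = k by rewrite divfK// f0.
exact: (adapted_gram (cf _) (cf _) (cf _)).
Qed.

End AdaptedGram.

Section FrameNonmetricity.
Variables (R : realType) (U : set (R * R)).
Hypothesis hU : open U.
Variables (g : R * R -> 'M[R]_4) (omega N : form1 R).
Hypothesis hg : is_metric U g.
Hypothesis hdec : metric_decomposition U g omega N.

Lemma J4K : J4 R *m J4 R = 1%:M.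
Proof. by rewrite /J4 scalar_m4 m4M; congr m4; ring. Qed.

(** Differentiate the Gram matrix F^T g F = f J with d g = - 2 g N and
    d F = F A, and solve for the matrix of N. *)
Lemma nonmetricity_frame (F : R * R -> 'M[R]_4) (f : R * R -> R) (A : 'M[R]_4) X p :
  smooth U F -> smooth U f -> U p -> F p \in unitmx -> f p != 0 ->
  (forall q, U q -> (F q)^T *m g q *m F q = f q *: J4 R) ->
  'D_X F p = F p *m A ->
  N p X *m F p = F p *m
    (2^-1 *: (A + J4 R *m A^T *m J4 R) - ('D_X f p / f p / 2)%:M).
Proof.
move=> sF sf Up uF f0 gram DF; have [sg _] := hg.
have [n Fn] : exists n, N p X *m F p = F p *m n.
  by exists (invmx (F p) *m (N p X *m F p)); rewrite mulKVmx.
have sFT := smooth_trmx hU sF; have sFTg := smooth_mulmx hU sFT sg.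
have dF := smooth_differentiable sF Up.
have T1 : (F p *m A)^T *m g p *m F p = f p *: (A^T *m J4 R).
  by rewrite trmx_mul -!mulmxA (mulmxA (F p)^T) gram// scalemxAr.
have T2 : (F p)^T *m (g p *m N p X) *m F p = f p *: (J4 R *m n).
  by rewrite -!mulmxA Fn !mulmxA gram// scalemxAl.
have T3 : (F p)^T *m g p *m (F p *m A) = f p *: (J4 R *m A).
  by rewrite mulmxA gram// scalemxAl.
have E : ((f p)^-1 * 'D_X f p) *: 1%:M = J4 R *m A^T *m J4 R - 2 *: n + A.
  have := derive_mulmx X (smooth_differentiable sFTg Up) dF.
  rewrite (derive_mulmx X (smooth_differentiable sFT Up) (smooth_differentiable sg Up)).
  rewrite (derive_trmx X dF) DF (derive_metric hU hg hdec)//.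
  rewrite (derive_eqU hU X gram Up).
  rewrite (derive_scalemx hU X sf (smooth_cst hU (J4 R)) Up).
  have -> : 'D_X (fun=> J4 R) p = 0 by exact: derive_cst.
  rewrite scaler0 addr0 mulmxDl mulmxN mulNmx -scalemxAr -scalemxAl T1 T2 T3.
  move=> /(congr1 (fun M => (f p)^-1 *: (J4 R *m M))).
  rewrite !mulmxDr mulmxN -!scalemxAr !(mulmxA (J4 R)) J4K !mul1mx !scalerDr scalerN.
  by rewrite !scalerA (mulrCA _ 2) mulVf// mulr1 !scale1r.
rewrite Fn; congr (_ *m _).
have -> : ('D_X f p / f p / 2)%:M = 2^-1 *: (((f p)^-1 * 'D_X f p) *: 1%:M : 'M[R]_4).
  by rewrite scalerA scalemx1; congr (_%:M); rewrite mulrC; congr (_ * _); exact: mulrC.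
set S := J4 R *m _ *m _ in E *.
by rewrite E -scalerBr [S - _ + A]addrAC [S + A]addrC subKr scalerA mulVf ?scale1r.
Qed.

End FrameNonmetricity.

(** * The matrix of chi + psi in an adapted frame *)

Section ThetaFunctions.
Variables (R : realType) (U : set (R * R)).
Hypothesis hU : open U.

Lemma is_derive_smooth (f : R * R -> R) (p X : R * R) : smooth U f -> U p ->
  is_derive p X f ('D_X f p).
Proof. by move=> sf Up; split=> //; apply/diff_derivable/smooth_differentiable. Qed.

Lemma is_derive_fD (f h : R * R -> R) (p X : R * R) (df dh : R) :
  is_derive p X f df -> is_derive p X h dh ->
  is_derive p X (fun q => f q + h q) (df + dh).
Proof. by move=> Df Dh; exact: (@is_deriveD _ _ _ f h). Qed.

Lemma is_derive_fB (f h : R * R -> R) (p X : R * R) (df dh : R) :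
  is_derive p X f df -> is_derive p X h dh ->
  is_derive p X (fun q => f q - h q) (df - dh).
Proof. by move=> Df Dh; exact: (@is_deriveB _ _ _ f h). Qed.

Lemma is_derive_fM (f h : R * R -> R) (p X : R * R) (df dh : R) :
  is_derive p X f df -> is_derive p X h dh ->
  is_derive p X (fun q => f q * h q) (df * h p + f p * dh).
Proof.
move=> Df Dh; apply: (is_derive_eq (@is_deriveM _ _ f h p X df dh Df Dh)).
by rewrite /GRing.scale /= addrC mulrC.
Qed.

Lemma is_derive_fMr (f : R * R -> R) (p X : R * R) (df k : R) :
  is_derive p X f df -> is_derive p X (fun q => f q * k) (df * k).
Proof.
move=> Df; apply: (is_derive_eq (is_derive_fM Df (is_derive_cst k p X))).
by rewrite mulr0 addr0.
Qed.

Lemma smooth_theta4 (u v w : R * R -> R) : smooth U u -> smooth U v -> smooth U w ->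
  smooth U (fun p => theta4 (u p) (v p) (w p)).
Proof.
move=> su sv sw; apply/smooth_mxP => //; apply: ord4P; apply: ord4P;
  [apply: (@smooth_eqU _ _ hU _ (fun=> 0 : R))|apply: (@smooth_eqU _ _ hU _ u)
  |apply: (@smooth_eqU _ _ hU _ v)|apply: (@smooth_eqU _ _ hU _ w)
  |apply: (@smooth_eqU _ _ hU _ (fun=> 0 : R))|apply: (@smooth_eqU _ _ hU _ (fun=> 0 : R))
  |apply: (@smooth_eqU _ _ hU _ (fun=> 0 : R))|apply: (@smooth_eqU _ _ hU _ v)
  |apply: (@smooth_eqU _ _ hU _ (fun=> 0 : R))|apply: (@smooth_eqU _ _ hU _ (fun=> 0 : R))
  |apply: (@smooth_eqU _ _ hU _ (fun=> 0 : R))|apply: (@smooth_eqU _ _ hU _ u)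
  |apply: (@smooth_eqU _ _ hU _ (fun=> 0 : R))|apply: (@smooth_eqU _ _ hU _ (fun=> 0 : R))
  |apply: (@smooth_eqU _ _ hU _ (fun=> 0 : R))|apply: (@smooth_eqU _ _ hU _ (fun=> 0 : R))];
  rewrite ?hU//; try (by move=> q _; rewrite mxE !inordK); exact: smooth_cst.
Qed.

Lemma derive_theta4 (u v w : R * R -> R) X p : smooth U u -> smooth U v -> smooth U w ->
  U p -> 'D_X (fun q => theta4 (u q) (v q) (w q)) p =
  theta4 ('D_X u p) ('D_X v p) ('D_X w p).
Proof.
move=> su sv sw Up.
have dT := smooth_differentiable (smooth_theta4 su sv sw) Up.
have E0 i j : (forall q, theta4 (u q) (v q) (w q) i j = 0) ->
    'D_X (fun q => theta4 (u q) (v q) (w q)) p i j = 0.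
  move=> E; apply: etrans (derive_mxE _ _ _ dT) _.
  by rewrite (derive_eqU hU X (fun q _ => E q) Up); exact: derive_cst.
have E1 (f : R * R -> R) i j : (forall q, theta4 (u q) (v q) (w q) i j = f q) ->
    'D_X (fun q => theta4 (u q) (v q) (w q)) p i j = 'D_X f p.
  move=> E; apply: etrans (derive_mxE _ _ _ dT) _.
  exact (derive_eqU hU X (fun q _ => E q) Up).
by apply/matrixP; apply: ord4P; apply: ord4P; rewrite [RHS]mxE !inordK//=;
  (apply: E0 || apply: E1) => q; rewrite mxE !inordK.
Qed.

End ThetaFunctions.

(** The conditions on v0, v1 and v2 leave only A v3 free, and skewness of A for
    G determines it. *)
Lemma skew_nilpotent_frame (R : realType) (v0 v1 v2 v3 : 'cV[R]_4)
    (F G A B : 'M[R]_4) (f u v w : R) :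
  F = cols4 v0 v1 v2 v3 -> F \in unitmx -> f != 0 ->
  F^T *m G *m F = f *: J4 R -> A^T *m G = - (G *m A) ->
  A *m v0 = 0 -> A *m v1 = u *: v0 -> A *m v2 = v *: v0 ->
  B *m v0 = 0 -> B *m v1 = 0 -> B *m v2 = 0 -> B *m v3 = w *: v0 ->
  (A + B) *m F = F *m theta4 u v w.
Proof.
move=> FE uF f0 gram Askew A0 uE vE B0 B1 B2 wE.
have [y yE] : exists y, A *m v3 = F *m y.
  by exists (invmx F *m (A *m v3)); rewrite mulKVmx.
have AF : A *m F = F *m m4 0 u v (y (inord 0) 0) 0 0 0 (y (inord 1) 0)
                           0 0 0 (y (inord 2) 0) 0 0 0 (y (inord 3) 0).
  by rewrite FE mul_cols4 cols4_m4 A0 uE vE yE FE cols4_mulv !scale0r !addr0.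
have gram' : F^T *m (G *m F) = f *: J4 R by rewrite mulmxA.
have : (A *m F)^T *m (G *m F) + F^T *m (G *m (A *m F)) = 0.
  by rewrite trmx_mul -!mulmxA (mulmxA A^T) Askew mulNmx mulmxN -mulmxA addNr.
rewrite AF trmx_mul -!mulmxA (mulmxA G F) (mulmxA F^T (G *m F)) gram'.
rewrite -scalemxAr -scalemxAl -scalerDr => /eqP.
rewrite scaler_eq0 (negbTE f0) /= => /eqP.
rewrite m4T /J4 !m4E zero_m4 => /m4_inj/=[[_ _ _ e0] [_ _ _ e1] [_ _ _ e2] [_ _ _ e3]].
have y0 : y (inord 0) 0 = 0 by lra.
have y1 : y (inord 1) 0 = v by lra.
have y2 : y (inord 2) 0 = u by lra.
have y3 : y (inord 3) 0 = 0 by lra.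
rewrite mulmxDl AF y0 y1 y2 y3 FE mul_cols4 B0 B1 B2 wE !cols4_m4.
by apply/matrixP => i; apply: ord4P; rewrite !mxE !inordK//= !mxE; ring.
Qed.

Section theta4Frame.
Variables (R : realType) (U : set (R * R)).
Variables (L : R * R -> set 'cV[R]_4) (sigma : R * R -> 'cV[R]_4).
Hypothesis hsigma : is_lift U L sigma.

Lemma gm1_gm2_frame (F G A B : 'M[R]_4) (f : R) (p : R * R) (s3 : 'cV[R]_4) :
  U p -> F = cols4 (sigma p) (pdx sigma p) (pdy sigma p) s3 -> F \in unitmx ->
  f != 0 -> F^T *m G *m F = f *: J4 R ->
  gm1 U L p A -> gskew G A -> gm2 U L p B ->
  exists u v w, (A + B) *m F = F *m theta4 u v w.
Proof.
move=> Up FE uF f0 gram [A1 A2] /gskewP Askew [B1 B2].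
have Asigma : A *m sigma p = 0.
  by apply: A1; apply/(E1P hsigma _ Up); exists 1; rewrite scale1r.
have [u uE] : exists u, A *m pdx sigma p = u *: sigma p.
  by apply/(E1P hsigma _ Up)/A2; exact: (E2_derive hsigma p (1, 0)).
have [v vE] : exists v, A *m pdy sigma p = v *: sigma p.
  by apply/(E1P hsigma _ Up)/A2; exact: (E2_derive hsigma p (0, 1)).
have [w wE] : exists w, B *m s3 = w *: sigma p.
  by apply/(E1P hsigma _ Up)/B2.
exists u, v, w.
apply: (skew_nilpotent_frame FE uF f0 gram Askew Asigma uE vE _ _ _ wE).
- by apply: B1; exact: (E2_sigma hsigma).
- by apply: B1; exact: (E2_derive hsigma p (1, 0)).
- by apply: B1; exact: (E2_derive hsigma p (0, 1)).
Qed.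

End theta4Frame.

(** * From Moebius-flatness to the differential system *)

Section SurfaceStructure.
Variables (R : realType) (U : set (R * R)).
Hypothesis hU : open U.
Variables (L : R * R -> set 'cV[R]_4) (sigma : R * R -> 'cV[R]_4).
Hypothesis hsigma : is_lift U L sigma.
Variables beta gamma V W : R * R -> R.
Hypothesis hbeta : smooth U beta.
Hypothesis hgamma : smooth U gamma.
Hypothesis hV : smooth U V.
Hypothesis hW : smooth U W.
Hypothesis hxx : forall p, U p ->
     pdx (pdx sigma) p =
       beta p *: pdy sigma p + (2^-1 * (V p - pdy beta p)) *: sigma p.
Hypothesis hyy : forall p, U p ->
     pdy (pdy sigma) p =
       gamma p *: pdx sigma p + (2^-1 * (W p - pdx gamma p)) *: sigma p.
Hypothesis hfree : forall p, U p ->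
     free [:: sigma p; pdx sigma p; pdy sigma p; pdy (pdx sigma) p].

Let ssigma : smooth U sigma.
Proof. by case: hsigma. Qed.

Definition conn (c e t : R * R -> R) (Z : R * R) (p : R * R) : 'M[R]_4 :=
  Z.1 *: connx beta gamma V W c e t p + Z.2 *: conny beta gamma V W c e t p.

Lemma derive_frame_conn c e t Z p : smooth U c -> smooth U e -> smooth U t ->
  U p -> 'D_Z (frame sigma c e t) p = frame sigma c e t p *m conn c e t Z p.
Proof.
move=> sc se st Up.
have dF := smooth_differentiable (smooth_frame hU ssigma sc se st) Up.
rewrite (derive_xy Z dF) (pdx_frame hU ssigma hbeta hV hxx hyy sc se st Up).
rewrite (pdy_frame hU ssigma hgamma hW hxx hyy sc se st Up).
by rewrite mulmxDr -!scalemxAr.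
Qed.

Lemma conn_ex c e t p : conn c e t (1, 0) p = connx beta gamma V W c e t p.
Proof. by rewrite /conn /= scale1r scale0r addr0. Qed.

Lemma conn_ey c e t p : conn c e t (0, 1) p = conny beta gamma V W c e t p.
Proof. by rewrite /conn /= scale1r scale0r add0r. Qed.

Section StructurePDE.
Variables c e t u1 v2 : R * R -> R.
Hypothesis sc : smooth U c.
Hypothesis se : smooth U e.
Hypothesis su1 : smooth U u1.
Hypothesis sv2 : smooth U v2.

(** The values that structure_eq_algebraic imposes on the coefficients of
    theta other than u1 and v2; shifted_a and shifted_b are the shifted unknowns of
    structure_eq_pde. *)
Definition mixed (p : R * R) : R := (beta p * gamma p - e p * c p) * 2^-1.
Definition wx (p : R * R) : R := e p * u1 p + beta p * v2 p.
Definition wy (p : R * R) : R := c p * v2 p + gamma p * u1 p.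
Definition shifted_a (p : R * R) : R := u1 p - (e p * beta p - c p * c p * 2^-1) * 2^-1.
Definition shifted_b (p : R * R) : R := v2 p - (c p * gamma p - e p * e p * 2^-1) * 2^-1.

Lemma smooth_shifted_a : smooth U shifted_a.
Proof.
have sh : smooth U (fun=> 2^-1 : R) by exact: smooth_cst.
apply: smoothB => //; apply: smoothM => //; apply: smoothB => //.
  exact: smoothM.
by apply: smoothM => //; exact: smoothM.
Qed.

Lemma smooth_shifted_b : smooth U shifted_b.
Proof.
have sh : smooth U (fun=> 2^-1 : R) by exact: smooth_cst.
apply: smoothB => //; apply: smoothM => //; apply: smoothB => //.
  exact: smoothM.
by apply: smoothM => //; exact: smoothM.
Qed.

(** structure_eq_pde for the functions themselves, once the derivatives of
    the dependent coefficients and of the shifted unknowns are computed. *)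
Lemma structure_eq_iff_pde p l l' : U p ->
  let M := Mx beta gamma c e t p in let P := Px beta V c e p in
  let M' := My beta gamma c e t p in let P' := Py gamma W c e p in
  let k := Kx beta gamma V W c e t p in let k' := Ky beta gamma V W c e t p in
  let p0 := coefp beta V p in let q0 := coefq gamma W p in
  theta4 (pdx mixed p) (pdx v2 p) (pdx wy p) - theta4 (pdy u1 p) (pdy mixed p) (pdy wx p)
  + commutator (connx beta gamma V W c e t p) (theta4 (mixed p) (v2 p) (wy p))
  - commutator (conny beta gamma V W c e t p) (theta4 (u1 p) (mixed p) (wx p))
  + commutator (nonmet_x (c p) (e p) (beta p) l ((P - p0) / 2) ((t p + M) / 2) k)
      (nonmet_y (c p) (e p) (gamma p) l' ((P' - q0) / 2) ((t p + M') / 2) k') = 0 <->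
  [/\ 2 * pdy beta p * shifted_b p + beta p * pdy shifted_b p =
         2 * pdx gamma p * shifted_a p + gamma p * pdx shifted_a p,
      2 * pdx shifted_b p = 2 * gamma p * pdy beta p + beta p * pdy gamma p
    & 2 * pdy shifted_a p = 2 * beta p * pdx gamma p + gamma p * pdx beta p].
Proof.
move=> Up M P M' P' k k' p0 q0.
have Dh X : 'D_X mixed p = ('D_X beta p * gamma p + beta p * 'D_X gamma p
    - ('D_X e p * c p + e p * 'D_X c p)) * 2^-1.
  apply: derive_val; apply: is_derive_fMr; apply: is_derive_fB;
    apply: is_derive_fM; exact: is_derive_smooth.
have Dwx : pdy wx p =
    (pdy e p * u1 p + e p * pdy u1 p) + (pdy beta p * v2 p + beta p * pdy v2 p).
  apply: derive_val; apply: is_derive_fD; apply: is_derive_fM;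
    exact: is_derive_smooth.
have Dwy : pdx wy p =
    (pdx c p * v2 p + c p * pdx v2 p) + (pdx gamma p * u1 p + gamma p * pdx u1 p).
  apply: derive_val; apply: is_derive_fD; apply: is_derive_fM;
    exact: is_derive_smooth.
have Da X : 'D_X shifted_a p = 'D_X u1 p - (('D_X e p * beta p + e p * 'D_X beta p)
    - ('D_X c p * c p + c p * 'D_X c p) * 2^-1) * 2^-1.
  apply: derive_val; apply: is_derive_fB; first exact: is_derive_smooth.
  apply: is_derive_fMr; apply: is_derive_fB; last apply: is_derive_fMr;
    apply: is_derive_fM; exact: is_derive_smooth.
have Db X : 'D_X shifted_b p = 'D_X v2 p - (('D_X c p * gamma p + c p * 'D_X gamma p)
    - ('D_X e p * e p + e p * 'D_X e p) * 2^-1) * 2^-1.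
  apply: derive_val; apply: is_derive_fB; first exact: is_derive_smooth.
  apply: is_derive_fMr; apply: is_derive_fB; last apply: is_derive_fMr;
    apply: is_derive_fM; exact: is_derive_smooth.
have -> : pdx mixed p = _ := Dh _.
have -> : pdy mixed p = _ := Dh _.
have -> : pdx shifted_a p = _ := Da _.
have -> : pdy shifted_a p = _ := Da _.
have -> : pdx shifted_b p = _ := Db _.
have -> : pdy shifted_b p = _ := Db _.
rewrite Dwx Dwy; exact: structure_eq_pde.
Qed.

End StructurePDE.

Section Necessity.
Variables (g : R * R -> 'M[R]_4) (omega N chi psi : form1 R).
Hypothesis hg : is_metric U g.
Hypothesis hdec : metric_decomposition U g omega N.
Hypothesis hchi : one_form U (fun p => gm1 U L p `&` gskew (g p)) chi.
Hypothesis hpsi : one_form U (gm2 U L) psi.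
Hypothesis chi_eq : forall p X Y, U p ->
  cov_ext_d omega chi p X Y = curvature omega p X Y.
Hypothesis psi_eq : forall p X Y, U p ->
  ext_d psi p X Y + wedge_bracket N chi p X Y = 0.

Let theta : form1 R := fun p X => chi p X + psi p X.

Lemma smooth_theta_form X : smooth U (fun p => theta p X).
Proof.
have [_ schi _] := hchi; have [_ spsi _] := hpsi.
exact: (smooth_addmx hU (schi X) (spsi X)).
Qed.

(** The sum of the two equations for chi and psi: the brackets with N cancel
    since omega = - N. *)
Lemma ext_d_theta p X Y : U p ->
  ext_d theta p X Y = - commutator (N p X) (N p Y).
Proof.
move=> Up; have [_ schi _] := hchi; have [_ spsi _] := hpsi.
rewrite -(curvature_nonmetricity hU hg hdec X Y Up) -chi_eq//.
have -> : ext_d theta p X Y = ext_d chi p X Y + ext_d psi p X Y.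
  rewrite /ext_d (derive_addmx X (schi Y) (spsi Y) Up).
  by rewrite (derive_addmx Y (schi X) (spsi X) Up) opprD addrACA.
have /eqP := psi_eq X Y Up; rewrite addr_eq0 => /eqP ->.
rewrite /cov_ext_d; congr (_ + _).
rewrite /wedge_bracket /commutator !(connection_form_opp hU hdec)//.
by rewrite !mulNmx !mulmxN -!opprD.
Qed.

Variables f c e t : R * R -> R.
Hypothesis sf : smooth U f.
Hypothesis sc : smooth U c.
Hypothesis se : smooth U e.
Hypothesis st : smooth U t.
Hypothesis f0 : forall p, U p -> f p != 0.
Hypothesis gram : forall p, U p ->
  (frame sigma c e t p)^T *m g p *m frame sigma c e t p = f p *: J4 R.

Let F := frame sigma c e t.
Let sF : smooth U F := smooth_frame hU ssigma sc se st.
Let uF p (Up : U p) : F p \in unitmx := unitmx_frame hfree c e t Up.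
Let a X p := invmx (F p) *m theta p X *m F p.
Let u X p := a X p (inord 0) (inord 1).
Let v X p := a X p (inord 0) (inord 2).
Let w X p := a X p (inord 0) (inord 3).

(** Since theta has this form pointwise, its coefficients are entries of
    F^-1 theta F, hence smooth functions. *)
Lemma theta_frame p X : U p -> theta p X *m F p = F p *m theta4 (u X p) (v X p) (w X p).
Proof.
move=> Up; have [_ _ /(_ p X Up)[chi1 chi2]] := hchi.
have [_ _ /(_ p X Up) psi2] := hpsi.
have [u' [v' [w' E]]] := gm1_gm2_frame hsigma Up erefl (uF Up) (f0 Up) (gram Up)
  chi1 chi2 psi2.
have aE : a X p = theta4 u' v' w' by rewrite /a -mulmxA [X in _ *m X]E mulKmx// uF.
rewrite /u /v /w aE ![theta4 _ _ _ (inord 0) _]mxE !inordK//=.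
Qed.

Let sa X i j : smooth U (fun p => a X p i j).
Proof.
have : smooth U (a X).
  apply: smooth_mulmx => //; apply: smooth_mulmx => //; last exact: smooth_theta_form.
  exact: smooth_invmx.
by move=> /(smooth_mxP hU); exact.
Qed.

Let su X : smooth U (u X) := sa X _ _.
Let sv X : smooth U (v X) := sa X _ _.
Let sw X : smooth U (w X) := sa X _ _.

Let lx p := pdx f p / f p / 2.
Let ly p := pdy f p / f p / 2.

(** ext_d_theta transported to the adapted frame. *)
Lemma theta_structure_eq p : U p ->
  let M := Mx beta gamma c e t p in let P := Px beta V c e p in
  let M' := My beta gamma c e t p in let P' := Py gamma W c e p in
  let k := Kx beta gamma V W c e t p in let k' := Ky beta gamma V W c e t p in
  let p0 := coefp beta V p in let q0 := coefq gamma W p in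
  theta4 (pdx (u (0, 1)) p) (pdx (v (0, 1)) p) (pdx (w (0, 1)) p)
  - theta4 (pdy (u (1, 0)) p) (pdy (v (1, 0)) p) (pdy (w (1, 0)) p)
  + commutator (connx beta gamma V W c e t p)
      (theta4 (u (0, 1) p) (v (0, 1) p) (w (0, 1) p))
  - commutator (conny beta gamma V W c e t p)
      (theta4 (u (1, 0) p) (v (1, 0) p) (w (1, 0) p))
  + commutator (nonmet_x (c p) (e p) (beta p) (lx p) ((P - p0) / 2) ((t p + M) / 2) k)
      (nonmet_y (c p) (e p) (gamma p) (ly p) ((P' - q0) / 2) ((t p + M') / 2) k') = 0.
Proof.
move=> Up M P M' P' k k' p0 q0.
have Nx : N p (1, 0) *m F p = F p *m
    nonmet_x (c p) (e p) (beta p) (lx p) ((P - p0) / 2) ((t p + M) / 2) k.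
  rewrite -symmetric_part_conn_x -/(connx beta gamma V W c e t p).
  rewrite -/(connx beta gamma V W c e t p).
  apply: (nonmetricity_frame hU hg hdec sF sf Up (uF Up) (f0 Up) gram).
  exact: (pdx_frame hU ssigma hbeta hV hxx hyy sc se st Up).
have Ny : N p (0, 1) *m F p = F p *m
    nonmet_y (c p) (e p) (gamma p) (ly p) ((P' - q0) / 2) ((t p + M') / 2) k'.
  rewrite -symmetric_part_conn_y -/(conny beta gamma V W c e t p).
  apply: (nonmetricity_frame hU hg hdec sF sf Up (uF Up) (f0 Up) gram).
  exact: (pdy_frame hU ssigma hgamma hW hxx hyy sc se st Up).
have NN := commutator_frame Nx Ny.
have E := frame_ext_d (a := fun Z q => theta4 (u Z q) (v Z q) (w Z q)) hU (1, 0) (0, 1)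
  sF Up (fun Z => derive_frame_conn Z sc se st Up) smooth_theta_form
  (fun Z => smooth_theta4 hU (su Z) (sv Z) (sw Z)) (fun q Z Uq => theta_frame Z Uq).
move: E; rewrite (ext_d_theta _ _ Up) mulNmx NN.
rewrite (derive_theta4 hU _ (su _) (sv _) (sw _) Up).
rewrite (derive_theta4 hU _ (su _) (sv _) (sw _) Up) conn_ex conn_ey.
move=> /(congr1 (mulmx (invmx (F p)))); rewrite mulmxN !mulKmx ?uF// => E.
by rewrite [X in X + _](esym E) addNr.
Qed.

Lemma necessity : exists a b : R * R -> R,
    [/\ smooth U a, smooth U b
      & forall p, U p ->
        [/\ 2 * pdy beta p * b p + beta p * pdy b p =
              2 * pdx gamma p * a p + gamma p * pdx a p,
            2 * pdx b p = 2 * gamma p * pdy beta p + beta p * pdy gamma p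
          & 2 * pdy a p = 2 * beta p * pdx gamma p + gamma p * pdx beta p]].
Proof.
have su1 : smooth U (u (1, 0)) := su _; have sv2 : smooth U (v (0, 1)) := sv _.
have alg p (Up : U p) := structure_eq_algebraic (theta_structure_eq Up).
have v1E p : U p -> v (1, 0) p = mixed c e p by move=> /alg[].
have u2E p : U p -> u (0, 1) p = mixed c e p by move=> /alg[].
have w1E p : U p -> w (1, 0) p = wx e (u (1, 0)) (v (0, 1)) p by move=> /alg[].
have w2E p : U p -> w (0, 1) p = wy c (u (1, 0)) (v (0, 1)) p by move=> /alg[].
exists (shifted_a c e (u (1, 0))), (shifted_b c e (v (0, 1))).
split; [exact: smooth_shifted_a|exact: smooth_shifted_b|move=> p Up].
have := theta_structure_eq Up; rewrite v1E// u2E// w1E// w2E//.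
have -> : pdx (u (0, 1)) p = pdx (mixed c e) p := derive_eqU hU (1, 0) u2E Up.
have -> : pdy (v (1, 0)) p = pdy (mixed c e) p := derive_eqU hU (0, 1) v1E Up.
have -> : pdx (w (0, 1)) p = _ := derive_eqU hU (1, 0) w2E Up.
have -> : pdy (w (1, 0)) p = _ := derive_eqU hU (0, 1) w1E Up.
by move/(structure_eq_iff_pde _ sc se su1 sv2 _ _ Up).
Qed.

End Necessity.
End SurfaceStructure.

(** * Two-forms, and the fibres of the second bundle *)

Section TwoForms.
Variables (R : realType) (U : set (R * R)).
Hypothesis hU : open U.

Lemma linear_form_xy (B : R * R -> 'M[R]_4) (X : R * R) :
  (forall (k : R) (X Y : R * R), B (k *: X + Y) = k *: B X + B Y) ->
  B X = X.1 *: B (1, 0) + X.2 *: B (0, 1).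
Proof.
move=> lB; have B0 : B 0 = 0.
  by have := lB (-1) 0 0; rewrite scaler0 addr0 scaleN1r addNr.
have {1}-> : X = X.1 *: ((1, 0) : R * R) + (X.2 *: ((0, 1) : R * R) + 0).
  case: X => x y /=; apply/eqP; rewrite addr0 xpair_eqE /=.
  by rewrite !scaler0 add0r addr0 /GRing.scale /= !mulr1 !eqxx.
by rewrite lB lB B0 addr0.
Qed.

(** The two equations for chi and psi concern arbitrary tangent vectors;
    both sides are two-forms, so the pair of coordinate vectors suffices. *)
Lemma alternating_form (B : R * R -> R * R -> 'M[R]_4) (X Y : R * R) :
  (forall (k : R) (X Y Z : R * R), B (k *: X + Y) Z = k *: B X Z + B Y Z) ->
  (forall X Y, B X Y = - B Y X) ->
  B X Y = (X.1 * Y.2 - X.2 * Y.1) *: B (1, 0) (0, 1).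
Proof.
move=> lB aB.
have B0 X0 : B X0 X0 = 0.
  have /eqP := aB X0 X0; rewrite -addr_eq0 -mulr2n -scaler_nat scaler_eq0.
  by rewrite pnatr_eq0 /= => /eqP.
have BE X0 Y0 : B X0 Y0 = X0.1 *: B (1, 0) Y0 + X0.2 *: B (0, 1) Y0.
  by apply: (linear_form_xy (B := B^~ Y0)) => k X1 Y1; exact: lB.
rewrite BE (aB (1, 0)) (aB (0, 1)) (BE Y) (BE Y) !B0 !scaler0 addr0 add0r.
rewrite (aB (0, 1) (1, 0)) !scalerN opprK scalerBl !scalerA.
by congr (_ - _); rewrite mulrC.
Qed.

Lemma derive_linear (V : normedModType R) (h : R * R -> V) (k : R) (X Y : R * R) p :
  differentiable h p -> 'D_(k *: X + Y) h p = k *: 'D_X h p + 'D_Y h p.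
Proof. by move=> dh; rewrite !deriveE// linearP. Qed.

Lemma ext_d_linear (P : R * R -> set 'M[R]_4) (alpha : form1 R) p (k : R)
    (X Y Z : R * R) : one_form U P alpha -> U p ->
  ext_d alpha p (k *: X + Y) Z = k *: ext_d alpha p X Z + ext_d alpha p Y Z.
Proof.
move=> [lin sm _] Up.
rewrite /ext_d derive_linear; last exact: smooth_differentiable (sm Z) Up.
have E q : U q -> alpha q (k *: X + Y) = (cst k q) *: alpha q X + alpha q Y.
  by move=> Uq; exact: lin.
rewrite (derive_eqU hU Z E Up).
have sk : smooth U (cst k : R * R -> R) by exact: smooth_cst.
rewrite (derive_addmx Z (smooth_scalemx hU sk (sm X)) (sm Y) Up).
rewrite (derive_scalemx hU Z sk (sm X) Up).
have -> : 'D_Z (cst k) p = 0 by exact: derive_cst.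
rewrite scale0r add0r scalerBr opprD; exact: addrACA.
Qed.

Lemma ext_dC (alpha : form1 R) p (X Y : R * R) :
  ext_d alpha p X Y = - ext_d alpha p Y X.
Proof. by rewrite /ext_d opprB. Qed.

Lemma commutator_linear (k : R) (A B C : 'M[R]_4) :
  commutator (k *: A + B) C = k *: commutator A C + commutator B C.
Proof.
by rewrite /commutator mulmxDl mulmxDr -scalemxAl -scalemxAr opprD addrACA scalerBr.
Qed.

Lemma commutatorC (A B : 'M[R]_4) : commutator A B = - commutator B A.
Proof. by rewrite /commutator opprB. Qed.

Lemma commutator_linearr (k : R) (A B C : 'M[R]_4) :
  commutator C (k *: A + B) = k *: commutator C A + commutator C B.
Proof. by rewrite commutatorC commutator_linear opprD -scalerN -!commutatorC. Qed.

Lemma wedge_bracket_linear (alpha eta : form1 R) p (k : R) (X Y Z : R * R) :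
  (forall (k : R) X Y, alpha p (k *: X + Y) = k *: alpha p X + alpha p Y) ->
  (forall (k : R) X Y, eta p (k *: X + Y) = k *: eta p X + eta p Y) ->
  wedge_bracket alpha eta p (k *: X + Y) Z =
  k *: wedge_bracket alpha eta p X Z + wedge_bracket alpha eta p Y Z.
Proof.
move=> lalpha leta; rewrite /wedge_bracket lalpha leta.
by rewrite commutator_linear commutator_linearr opprD addrACA -scalerBr.
Qed.

Lemma wedge_bracketC (alpha eta : form1 R) p (X Y : R * R) :
  wedge_bracket alpha eta p X Y = - wedge_bracket alpha eta p Y X.
Proof. by rewrite /wedge_bracket [RHS]opprB. Qed.

Lemma wedge_bracketNl (alpha eta : form1 R) p (X Y : R * R) :
  wedge_bracket (fun p Z => - alpha p Z) eta p X Y = - wedge_bracket alpha eta p X Y.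
Proof.
have cN (A B : 'M[R]_4) : commutator (- A) B = - commutator A B.
  by rewrite /commutator mulNmx mulmxN [RHS]opprD.
by rewrite /wedge_bracket !cN [RHS]opprD.
Qed.

Lemma scaler_add3 (k : R) (A A' B B' C C' : 'M[R]_4) :
  (k *: A + A') + (k *: B + B') + (k *: C + C') =
  k *: (A + B + C) + (A' + B' + C').
Proof. by rewrite !scalerDr -[RHS]addrACA; congr (_ + _); rewrite addrACA. Qed.

Lemma derive_bform (g : R * R -> 'M[R]_4) (s t : R * R -> 'cV[R]_4) X p :
  smooth U g -> smooth U s -> smooth U t -> U p ->
  'D_X (fun q => bform (g q) (s q) (t q)) p =
  bform ('D_X g p) (s p) (t p) + bform (g p) ('D_X s p) (t p)
  + bform (g p) (s p) ('D_X t p).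
Proof.
move=> sg ss st Up.
have ssg := smooth_mulmx hU (smooth_trmx hU ss) sg.
have dsgt := smooth_differentiable (smooth_mulmx hU ssg st) Up.
have ds := smooth_differentiable ss Up.
have dsT := smooth_differentiable (smooth_trmx hU ss) Up.
have := derive_mulmx X (smooth_differentiable ssg Up) (smooth_differentiable st Up).
rewrite (derive_mulmx X dsT (smooth_differentiable sg Up)) (derive_trmx X ds).
move=> /matrixP/(_ ord0 ord0); rewrite (derive_mxE _ _ _ dsgt) => ->.
by rewrite mulmxDl 2!mxE [bform _ _ _ + _]addrC.
Qed.

End TwoForms.

Section Comb3.
Variables (R : realType) (v0 v1 v2 : 'cV[R]_4).

Definition comb3 (v : 'cV[R]_4) : Prop :=
  exists x0 x1 x2 : R, v = x0 *: v0 + x1 *: v1 + x2 *: v2.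

Lemma comb3_first (k : R) : comb3 (k *: v0).
Proof. by exists k, 0, 0; rewrite !scale0r !addr0. Qed.

Lemma comb3_leibniz (k h x y : R) : comb3 (k *: v0 + h *: (x *: v1 + y *: v2)).
Proof. by exists k, (h * x), (h * y); rewrite scalerDr !scalerA addrA. Qed.

Lemma comb3_sum n (k : 'I_n -> R) (w : 'I_n -> 'cV[R]_4) :
  (forall i, comb3 (w i)) -> comb3 (\sum_(i < n) k i *: w i).
Proof.
elim: n k w => [|n IH] k w wE.
  by exists 0, 0, 0; rewrite big_ord0 !scale0r !addr0.
have [x0 [x1 [x2 E]]] := wE ord0.
have [y0 [y1 [y2 E']]] := IH (fun i => k (lift ord0 i)) (fun i => w (lift ord0 i))
  (fun i => wE (lift ord0 i)).
exists (k ord0 * x0 + y0), (k ord0 * x1 + y1), (k ord0 * x2 + y2).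
rewrite big_ord_recl E E' !scalerDr !scalerA !scalerDl.
by rewrite addrACA; congr (_ + _); rewrite addrACA.
Qed.

Lemma linspan3 (S : set 'cV[R]_4) v : S v0 -> S v1 -> S v2 ->
  (forall w, S w -> comb3 w) -> linspan S v <-> comb3 v.
Proof.
move=> S0 S1 S2 SE; split=> [[n [k [w [wE ->]]]]|[x0 [x1 [x2 ->]]]].
  by apply: comb3_sum => i; exact/SE/wE.
exists 3%N, (fun i => nth 0 [:: x0; x1; x2] i), (fun i => nth 0 [:: v0; v1; v2] i).
split; first by case=> -[|[|[|//]]].
by rewrite !big_ord_recl big_ord0 addr0 /= addrA.
Qed.

End Comb3.

Section EnvelopeSpan.
Variables (R : realType) (U : set (R * R)).
Hypothesis hU : open U.
Variables (L : R * R -> set 'cV[R]_4) (sigma : R * R -> 'cV[R]_4).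
Hypothesis hsigma : is_lift U L sigma.
Hypothesis hfree : forall p, U p ->
     free [:: sigma p; pdx sigma p; pdy sigma p; pdy (pdx sigma) p].

Let ssigma : smooth U sigma.
Proof. by case: hsigma. Qed.

(** The coefficient is smooth because it is a coordinate in the smooth frame
    sigma, sigma_x, sigma_y, sigma_xy. *)
Lemma bundle_section_coord s : bundle_section U L s ->
  exists2 k : R * R -> R, smooth U k & forall p, U p -> s p = k p *: sigma p.
Proof.
move=> [ss Ls].
have ss1 := smooth_derive (1, 0) ssigma; have ss2 := smooth_derive (0, 1) ssigma.
have ss3 := smooth_derive (0, 1) ss1.
pose F p := cols4 (sigma p) (pdx sigma p) (pdy sigma p) (pdy (pdx sigma) p).
have uF p : U p -> F p \in unitmx by move=> Up; exact/unitmx_cols4/hfree.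
have sF : smooth U F := smooth_cols4 hU ssigma ss1 ss2 ss3.
exists (fun p => (invmx (F p) *m s p) (inord 0) ord0).
  have := smooth_mulmx hU (smooth_invmx hU uF sF) ss.
  by move=> /(smooth_mxP hU)/(_ (inord 0) ord0).
move=> p Up; have [k sE] := (E1P hsigma _ Up).1 (Ls p Up).
have FE : F p *m (k *: delta_mx (inord 0) 0) = k *: sigma p.
  rewrite -scalemxAr -colE; congr (_ *: _).
  by apply/matrixP => i j; rewrite !mxE inordK//= ord1.
by rewrite sE -[in RHS]FE mulKmx ?uF// !mxE !eqxx mulr1.
Qed.

(** By the Leibniz rule, the derivatives of a multiple of sigma are
    combinations of sigma and its first derivatives. *)
Lemma E2P p v : U p -> E2 U L p v <-> exists x0 x1 x2 : R,
  v = x0 *: sigma p + x1 *: pdx sigma p + x2 *: pdy sigma p.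
Proof.
move=> Up; have sec := bundle_section_sigma hsigma.
apply: linspan3.
- by exists sigma => //; left.
- by exists sigma => //; right; exists (1, 0).
- by exists sigma => //; right; exists (0, 1).
move=> w [s secs].
have [h sh sE] := bundle_section_coord secs; case=> [->|[X ->]].
  by rewrite (sE p Up); exact: comb3_first.
rewrite (derive_eqU hU X sE Up) (derive_scalemx hU X sh ssigma Up).
rewrite (derive_xy X (smooth_differentiable ssigma Up)).
exact: comb3_leibniz.
Qed.

End EnvelopeSpan.

(** * Matrix identities for the converse *)

Section FrameAlgebra.
Variable R : realType.

Lemma J4_tr : (J4 R)^T = J4 R.
Proof. by rewrite /J4 m4T. Qed.

(** n is the part of A that is symmetric for J4; the second identity says that
    2 J n is the symmetrization of J A. *)
Lemma symmetric_part_J4 (A : 'M[R]_4) :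
  let n := 2^-1 *: (A + J4 R *m A^T *m J4 R) in
  n^T *m J4 R = J4 R *m n /\ 2 *: (J4 R *m n) = A^T *m J4 R + J4 R *m A.
Proof.
have JK B : J4 R *m (J4 R *m B) = B by rewrite mulmxA J4K mul1mx.
move=> n; rewrite /n linearZ linearD /= !trmx_mul trmxK J4_tr.
rewrite -scalemxAl -scalemxAr mulmxDl mulmxDr -!mulmxA J4K mulmx1 JK.
by rewrite addrC scalerA divff// scale1r addrC.
Qed.

Lemma gram_mulr (F g N n J : 'M[R]_4) : F^T *m g *m F = J -> N *m F = F *m n ->
  F^T *m (g *m N) *m F = J *m n.
Proof. by move=> <- NF; rewrite -!mulmxA NF. Qed.

Lemma mulmxNZ (P B Q : 'M[R]_4) (k : R) :
  P *m - (k *: B) *m Q = - (k *: (P *m B *m Q)).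
Proof. by rewrite mulmxN mulNmx -scalemxAr -scalemxAl. Qed.

Lemma gram_mull (F g N n J : 'M[R]_4) : F^T *m g *m F = J -> N *m F = F *m n ->
  F^T *m (N^T *m g) *m F = n^T *m J.
Proof. by move=> <- NF; rewrite !mulmxA -!trmx_mul NF. Qed.

Lemma frameD (B C b c F : 'M[R]_4) : B *m F = F *m b -> C *m F = F *m c ->
  (B + C) *m F = F *m (b + c).
Proof. by move=> EB EC; rewrite mulmxDl EB EC mulmxDr. Qed.

Lemma frameB (B C b c F : 'M[R]_4) : B *m F = F *m b -> C *m F = F *m c ->
  (B - C) *m F = F *m (b - c).
Proof. by move=> EB EC; rewrite mulmxBl EB EC mulmxBr. Qed.

Lemma theta4_comb (k l u v w u' v' w' : R) :
  k *: theta4 u v w + l *: theta4 u' v' w' =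
  theta4 (k * u + l * u') (k * v + l * v') (k * w + l * w').
Proof. by rewrite /theta4 !m4E; congr m4; ring. Qed.

Lemma theta4_skew (u v : R) : (theta4 u v 0)^T *m J4 R = - (J4 R *m theta4 u v 0).
Proof. by rewrite /theta4 /J4 m4T !m4E; congr m4; ring. Qed.

Lemma theta4D (u v w w' : R) : theta4 u v w + theta4 0 0 w' = theta4 u v (w + w').
Proof. by rewrite /theta4 !m4E; congr m4; ring. Qed.

Lemma theta4_columns (v0 v1 v2 v3 : 'cV[R]_4) (B : 'M[R]_4) (u v w : R) :
  B *m cols4 v0 v1 v2 v3 = cols4 v0 v1 v2 v3 *m theta4 u v w ->
  [/\ B *m v0 = 0, B *m v1 = u *: v0, B *m v2 = v *: v0
    & B *m v3 = w *: v0 + v *: v1 + u *: v2].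
Proof.
rewrite mul_cols4 cols4_m4 => /cols4_inj[-> -> -> ->].
by rewrite !scale0r !addr0.
Qed.

Lemma theta4_comb3 (v0 v1 v2 v3 : 'cV[R]_4) (B : 'M[R]_4) (u v w x0 x1 x2 : R) :
  B *m cols4 v0 v1 v2 v3 = cols4 v0 v1 v2 v3 *m theta4 u v w ->
  B *m (x0 *: v0 + x1 *: v1 + x2 *: v2) = (x1 * u + x2 * v) *: v0.
Proof.
move=> /theta4_columns[B0 B1 B2 _].
by rewrite !mulmxDr -!scalemxAr B0 B1 B2 scaler0 add0r !scalerA scalerDl.
Qed.

Lemma theta400_range (v0 v1 v2 v3 y : 'cV[R]_4) (B : 'M[R]_4) (w : R) :
  B *m cols4 v0 v1 v2 v3 = cols4 v0 v1 v2 v3 *m theta4 0 0 w ->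
  B *m (cols4 v0 v1 v2 v3 *m y) = (y (inord 3) 0 * w) *: v0.
Proof.
move=> /theta4_columns[B0 B1 B2 B3]; rewrite cols4_mulv !mulmxDr -!scalemxAr.
by rewrite B0 B1 B2 B3 !scale0r !scaler0 !addr0 !add0r scalerA.
Qed.

Lemma structure_split (X Y : 'M[R]_4) (u1 v1 u2 v2 u1' v1' u2' v2' w1 w2 w1' w2' : R) :
  (theta4 u2' v2' 0 - theta4 u1' v1' 0
   + commutator X (theta4 u2 v2 0) - commutator Y (theta4 u1 v1 0))
  + (theta4 0 0 w2' - theta4 0 0 w1'
     + commutator X (theta4 0 0 w2) - commutator Y (theta4 0 0 w1))
  = theta4 u2' v2' w2' - theta4 u1' v1' w1' + commutator X (theta4 u2 v2 w2)
    - commutator Y (theta4 u1 v1 w1).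
Proof.
have E (u v w : R) : theta4 u v w = theta4 u v 0 + theta4 0 0 w by rewrite theta4D add0r.
have CD (A B C : 'M[R]_4) : commutator A (B + C) = commutator A B + commutator A C.
  by rewrite -[B]scale1r commutator_linearr !scale1r.
rewrite (E u2' v2' w2') (E u1' v1' w1') (E u2 v2 w2) (E u1 v1 w1) !CD.
move: (theta4 _ _ 0) (theta4 _ _ 0) (theta4 0 0 _) (theta4 0 0 _)
  (commutator X _) (commutator X _)
  (commutator Y _) (commutator Y _) => *.
by apply/matrixP => i j; rewrite !mxE; ring.
Qed.

Lemma flag_columns (v0 v1 v2 v3 : 'cV[R]_4) (B : 'M[R]_4)
    (x00 x01 x02 x03 x11 x12 x13 x21 x22 x23 x33 : R) :
  B *m cols4 v0 v1 v2 v3 = cols4 v0 v1 v2 v3 *m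
    m4 x00 x01 x02 x03 0 x11 x12 x13 0 x21 x22 x23 0 0 0 x33 ->
  B *m v0 = x00 *: v0 /\ forall v, comb3 v0 v1 v2 v -> comb3 v0 v1 v2 (B *m v).
Proof.
rewrite mul_cols4 cols4_m4 => /cols4_inj[E0 E1 E2 _].
move: E0 E1 E2; rewrite !scale0r !addr0 => E0 E1 E2; split=> // v [y0 [y1 [y2 ->]]].
exists (y0 * x00 + y1 * x01 + y2 * x02), (y1 * x11 + y2 * x12), (y1 * x21 + y2 * x22).
rewrite !mulmxDr -!scalemxAr E0 E1 E2.
by apply/matrixP => i j; rewrite !mxE; ring.
Qed.

Lemma nonmet_flag (x y c e b l r s k c' e' g l' r' s' k' : R) :
  exists x00 x01 x02 x03 x11 x12 x13 x21 x22 x23 x33 : R,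
  x *: nonmet_x c e b l r s k + y *: nonmet_y c' e' g l' r' s' k' =
    m4 x00 x01 x02 x03 0 x11 x12 x13 0 x21 x22 x23 0 0 0 x33.
Proof.
do 11!eexists; rewrite /nonmet_x /nonmet_y !m4E; congr m4; rewrite ?mulr0 ?addr0//.
Qed.

(** The matrix of d psi + [N /\ chi] in the frame with c = e = t = 0. The last
    hypothesis takes care of its upper right entry; in the application it is the
    first equation of the system. *)
Lemma psi_equation (b g p q M P M' P' k k' r r' s s' u1 v2 h w1 w2 w1y w2x : R) :
  w1 = b * v2 -> w2 = g * u1 ->
  2 * r = P - p -> 2 * r' = P' - q -> 2 * s = M -> 2 * s' = M' -> M = M' ->
  w2x + 2 * r' * u1 = w1y + 2 * r * v2 ->
  theta4 0 0 w2x - theta4 0 0 w1y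
  + commutator (conn_mx_x 0 0 p 0 b M P k) (theta4 0 0 w2)
  - commutator (conn_mx_y 0 0 q 0 g M' P' k') (theta4 0 0 w1)
  + (commutator (nonmet_x 0 0 b 0 r s k) (theta4 h v2 0)
     - commutator (nonmet_y 0 0 g 0 r' s' k') (theta4 u1 h 0)) = 0.
Proof.
move=> -> -> e1 e2 e3 e4 e5 e6.
have -> : P = p + 2 * r by lra.
have -> : P' = q + 2 * r' by lra.
have -> : w2x = w1y + 2 * r * v2 - 2 * r' * u1 by lra.
have -> : s = M' / 2 by lra.
have -> : s' = M' / 2 by lra.
rewrite e5 /commutator /theta4 /conn_mx_x /conn_mx_y /nonmet_x /nonmet_y.
by rewrite !m4E zero_m4; congr m4; lra.
Qed.

End FrameAlgebra.

(** * From the differential system to Moebius-flatness *)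

Section Sufficiency.
Variables (R : realType) (U : set (R * R)).
Hypothesis hU : open U.
Variables (L : R * R -> set 'cV[R]_4) (sigma : R * R -> 'cV[R]_4).
Hypothesis hsigma : is_lift U L sigma.
Variables beta gamma V W : R * R -> R.
Hypothesis hbeta : smooth U beta.
Hypothesis hgamma : smooth U gamma.
Hypothesis hV : smooth U V.
Hypothesis hW : smooth U W.
Hypothesis hxx : forall p, U p ->
     pdx (pdx sigma) p =
       beta p *: pdy sigma p + (2^-1 * (V p - pdy beta p)) *: sigma p.
Hypothesis hyy : forall p, U p ->
     pdy (pdy sigma) p =
       gamma p *: pdx sigma p + (2^-1 * (W p - pdx gamma p)) *: sigma p.
Hypothesis hfree : forall p, U p ->
     free [:: sigma p; pdx sigma p; pdy sigma p; pdy (pdx sigma) p].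

Let ssigma : smooth U sigma.
Proof. by case: hsigma. Qed.

Let z : R * R -> R := fun=> 0.
Let sz : smooth U z := smooth_cst hU 0.
Let F := frame sigma z z z.
Let sF : smooth U F := smooth_frame hU ssigma sz sz sz.
Let uF p (Up : U p) : F p \in unitmx := unitmx_frame hfree z z z Up.
Let A := conn beta gamma V W z z z.
Let DF Z p (Up : U p) : 'D_Z F p = F p *m A Z p :=
  derive_frame_conn hU hsigma hbeta hgamma hV hW hxx hyy Z sz sz sz Up.
Let sVF : smooth U (fun p => invmx (F p)) := smooth_invmx hU uF sF.

Lemma smooth_conn Z : smooth U (A Z).
Proof.
apply: (smooth_eqU hU _ (smooth_mulmx hU sVF (smooth_derive Z sF))) => p Up.
by rewrite DF// mulKmx// uF.
Qed.

Lemma conn_linear (k : R) X Y p : A (k *: X + Y) p = k *: A X p + A Y p.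
Proof.
rewrite /A /conn /= /GRing.scale /=; case: X Y => x1 x2 [y1 y2] /=.
by apply/matrixP => i j; rewrite !mxE; ring.
Qed.

Let n Z p : 'M[R]_4 := 2^-1 *: (A Z p + J4 R *m (A Z p)^T *m J4 R).

Lemma smooth_sym_conn Z : smooth U (n Z).
Proof.
apply: smooth_scalemx => //; first exact: smooth_cst.
apply: smooth_addmx => //; first exact: smooth_conn.
apply: smooth_mulmx => //; last exact: smooth_cst.
apply: smooth_mulmx => //; first exact: smooth_cst.
by apply: smooth_trmx => //; exact: smooth_conn.
Qed.

Lemma sym_conn_linear (k : R) X Y p : n (k *: X + Y) p = k *: n X p + n Y p.
Proof.
rewrite /n conn_linear.
have -> : (k *: A X p + A Y p)^T = k *: (A X p)^T + (A Y p)^T by rewrite linearP.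
rewrite mulmxDr mulmxDl -scalemxAr -scalemxAl.
by rewrite addrACA -scalerDr [LHS]scalerDr scalerA (mulrC 2^-1) -scalerA.
Qed.

Let in_frame (B : R * R -> R * R -> 'M[R]_4) : form1 R :=
  fun p Z => F p *m B Z p *m invmx (F p).

Lemma in_frame_F B p Z : U p -> in_frame B p Z *m F p = F p *m B Z p.
Proof. by move=> Up; rewrite /in_frame mulmxKV// uF. Qed.

Lemma one_form_in_frame (P : R * R -> set 'M[R]_4) B :
  (forall k X Y p, B (k *: X + Y) p = k *: B X p + B Y p) ->
  (forall Z, smooth U (B Z)) -> (forall p Z, U p -> P p (in_frame B p Z)) ->
  one_form U P (in_frame B).
Proof.
move=> lB sB PB; split=> [p Up k X Y|X|p X Up]; last exact: PB.
  by rewrite /in_frame lB mulmxDr mulmxDl -scalemxAr -scalemxAl.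
by apply: smooth_mulmx => //; exact: smooth_mulmx.
Qed.

Let g p : 'M[R]_4 := (invmx (F p))^T *m J4 R *m invmx (F p).
Let N := in_frame n.
Let omega : form1 R := fun p Z => - N p Z.

Lemma gram_canonical p : U p -> (F p)^T *m g p *m F p = J4 R.
Proof.
move=> Up; rewrite /g !mulmxA -trmx_mul mulVmx ?uF// trmx1 mul1mx.
by rewrite -mulmxA mulVmx ?uF// mulmx1.
Qed.

Lemma smooth_canonical : smooth U g.
Proof.
apply: smooth_mulmx => //; apply: smooth_mulmx => //; last exact: smooth_cst.
exact: smooth_trmx.
Qed.

Lemma is_metric_canonical : is_metric U g.
Proof.
split; [exact: smooth_canonical|move=> p Up; split].
  by rewrite /g !trmx_mul trmxK J4_tr mulmxA.
rewrite /g !unitmx_mul unitmx_tr !unitmx_inv uF// andbT.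
by have /mulmx1_unit[] := J4K R.
Qed.

Lemma frame_cancel (B C : 'M[R]_4) p : U p ->
  (F p)^T *m B *m F p = (F p)^T *m C *m F p -> B = C.
Proof.
move=> Up E; have uFT : (F p)^T \in unitmx by rewrite unitmx_tr uF.
by rewrite -[B](mulKmx uFT) -[_ *m B](mulmxK (uF Up)) E mulmxK ?uF// mulKmx.
Qed.

Lemma gsym_canonical p Z : U p -> (N p Z)^T *m g p = g p *m N p Z.
Proof.
move=> Up; apply: (frame_cancel Up); have [nJ _] := symmetric_part_J4 (A Z p).
have gF := gram_canonical Up; have NF := in_frame_F n Z Up.
by rewrite (gram_mulr gF NF) (gram_mull gF NF) nJ.
Qed.

Lemma derive_canonical p Z : U p -> 'D_Z g p = - (2 *: (g p *m N p Z)).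
Proof.
move=> Up; apply: (frame_cancel Up); have [_ nJ] := symmetric_part_J4 (A Z p).
have gF := gram_canonical Up; have sg := smooth_canonical.
have sFT := smooth_trmx hU sF; have dF := smooth_differentiable sF Up.
have := derive_mulmx Z (smooth_differentiable (smooth_mulmx hU sFT sg) Up) dF.
rewrite (derive_mulmx Z (smooth_differentiable sFT Up) (smooth_differentiable sg Up)).
rewrite (derive_trmx Z dF) DF// (derive_eqU hU Z gram_canonical Up).
have -> : 'D_Z (fun=> J4 R) p = 0 by exact: derive_cst.
have T1 : (F p *m A Z p)^T *m g p *m F p = (A Z p)^T *m J4 R.
  by rewrite trmx_mul -gF !mulmxA.
have T3 : (F p)^T *m g p *m (F p *m A Z p) = J4 R *m A Z p.
  by rewrite mulmxA gF.
rewrite mulmxDl T1 T3 addrAC -nJ => /esym/eqP; rewrite addrC addr_eq0 => /eqP ->.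
by rewrite mulmxNZ (gram_mulr gF (in_frame_F n Z Up)).
Qed.

Lemma metric_decomposition_canonical : metric_decomposition U g omega N.
Proof.
have oN (P : R * R -> set 'M[R]_4) : (forall p Z, U p -> P p (N p Z)) ->
    one_form U P N.
  by move=> PN; apply: one_form_in_frame => //;
    [move=> *; exact: sym_conn_linear|exact: smooth_sym_conn].
have [lN sN _] := oN (fun=> setT) (fun _ _ _ => I).
split.
- split=> // [p Up k X Y|X]; last exact: smooth_oppmx.
  by rewrite /omega lN// opprD scalerN.
- move=> s t ss st p X Up.
  rewrite (derive_bform hU X smooth_canonical ss st Up) derive_canonical//.
  rewrite /covd /omega !mulNmx bformDl bformDr bformNl bformNr.
  have -> : bform (g p) (N p X *m s p) (t p) = bform (g p *m N p X) (s p) (t p).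
    by rewrite -[X in bform _ _ X]mul1mx bformE mulmx1 gsym_canonical.
  have -> : bform (g p) (s p) (N p X *m t p) = bform (g p *m N p X) (s p) (t p).
    by rewrite -[X in bform _ X]mul1mx bformE trmx1 mul1mx.
  rewrite bformN bformZ.
  by move: (bform _ _ _) (bform _ _ _) (bform _ _ _) => x y w; lra.
- by apply: oN => p Z Up; apply/gsymP; exact: gsym_canonical.
- by move=> s ss p X Up; rewrite /covd /omega mulNmx addrNK.
Qed.

Lemma sym_conn_ex p : n (1, 0) p =
  nonmet_x (z p) (z p) (beta p) 0 ((Px beta V z z p - coefp beta V p) / 2)
     ((z p + Mx beta gamma z z z p) / 2) (Kx beta gamma V W z z z p).
Proof.
rewrite -symmetric_part_conn_x -/(connx beta gamma V W z z z p).
by rewrite /n /A conn_ex raddf0 subr0.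
Qed.

Lemma sym_conn_ey p : n (0, 1) p =
  nonmet_y (z p) (z p) (gamma p) 0 ((Py gamma W z z p - coefq gamma W p) / 2)
     ((z p + My beta gamma z z z p) / 2) (Ky beta gamma V W z z z p).
Proof.
rewrite -symmetric_part_conn_y -/(conny beta gamma V W z z z p).
by rewrite /n /A conn_ey raddf0 subr0.
Qed.

Lemma sym_conn_xy Z p : n Z p = Z.1 *: n (1, 0) p + Z.2 *: n (0, 1) p.
Proof. by apply: (linear_form_xy (B := n^~ p)) => k X Y; exact: sym_conn_linear. Qed.

(** The matrices nonmet_x and nonmet_y are block triangular for the flag spanned by the
    first vector and by the first three vectors. *)
Lemma envelopes_canonical : envelopes U L g N.
Proof.
split=> [p Up u v /(E1P hsigma _ Up)[k ->] /(E1P hsigma _ Up)[l ->]|p Z Up].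
  rewrite bformZl bformZr.
  have := etrans (esym (gram_cols4 _ _ _ _ _)) (gram_canonical Up).
  move=> /m4_inj[[-> _ _ _] _ _ _].
  by rewrite !mulr0.
have := in_frame_F n Z Up; rewrite sym_conn_xy sym_conn_ex sym_conn_ey.
have [x00 [x01 [x02 [x03 [x11 [x12 [x13 [x21 [x22 [x23 [x33 ->]]]]]]]]]]] :=
  nonmet_flag Z.1 Z.2 (z p) (z p) (beta p) 0 ((Px beta V z z p - coefp beta V p) / 2)
     ((z p + Mx beta gamma z z z p) / 2) (Kx beta gamma V W z z z p)
     (z p) (z p) (gamma p) 0 ((Py gamma W z z p - coefq gamma W p) / 2)
     ((z p + My beta gamma z z z p) / 2) (Ky beta gamma V W z z z p).
move=> /flag_columns[N0 N2]; split=> v.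
  move=> /(E1P hsigma _ Up)[k ->]; apply/(E1P hsigma _ Up); exists (k * x00).
  by rewrite -scalemxAr N0 scalerA.
by move=> /(E2P hU hsigma hfree _ Up)/N2/(E2P hU hsigma hfree _ Up).
Qed.

Section Potentials.
Variables a b : R * R -> R.
Hypothesis sa : smooth U a.
Hypothesis sb : smooth U b.

Let h := mixed beta gamma z z.
Let w1 := wx beta z a b.
Let w2 := wy gamma z a b.

Let sh : smooth U h.
Proof.
apply: smoothM => //; last exact: smooth_cst.
by apply: smoothB => //; apply: smoothM.
Qed.

Let sw1 : smooth U w1.
Proof. by apply: smoothD => //; exact: smoothM. Qed.

Let sw2 : smooth U w2.
Proof. by apply: smoothD => //; exact: smoothM. Qed.

Definition chi_mx (Z p : R * R) : 'M[R]_4 :=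
  theta4 (Z.1 * a p + Z.2 * h p) (Z.1 * h p + Z.2 * b p) 0.

Definition psi_mx (Z p : R * R) : 'M[R]_4 := theta4 0 0 (Z.1 * w1 p + Z.2 * w2 p).

Lemma smooth_comb (k l : R) (f1 f2 : R * R -> R) : smooth U f1 -> smooth U f2 ->
  smooth U (fun p => k * f1 p + l * f2 p).
Proof.
by move=> s1 s2; apply: smoothD => //; apply: smoothM => //; exact: smooth_cst.
Qed.

Lemma smooth_chi_mx Z : smooth U (chi_mx Z).
Proof.
exact: (smooth_theta4 hU (smooth_comb Z.1 Z.2 sa sh) (smooth_comb Z.1 Z.2 sh sb)
  (smooth_cst hU 0)).
Qed.

Lemma smooth_psi_mx Z : smooth U (psi_mx Z).
Proof.
exact: (smooth_theta4 hU (smooth_cst hU 0) (smooth_cst hU 0)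
  (smooth_comb Z.1 Z.2 sw1 sw2)).
Qed.

Lemma chi_mx_linear (k : R) X Y p :
  chi_mx (k *: X + Y) p = k *: chi_mx X p + chi_mx Y p.
Proof.
rewrite -[chi_mx Y p]scale1r /chi_mx theta4_comb.
case: X Y => x1 x2 [y1 y2] /=; rewrite /GRing.scale /=.
by congr theta4; ring.
Qed.

Lemma psi_mx_linear (k : R) X Y p :
  psi_mx (k *: X + Y) p = k *: psi_mx X p + psi_mx Y p.
Proof.
rewrite -[psi_mx Y p]scale1r /psi_mx theta4_comb.
case: X Y => x1 x2 [y1 y2] /=; rewrite /GRing.scale /=.
by congr theta4; ring.
Qed.

Let chi := in_frame chi_mx.
Let psi := in_frame psi_mx.

Lemma one_form_chi : one_form U (fun p => gm1 U L p `&` gskew (g p)) chi.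
Proof.
apply: one_form_in_frame; [exact: chi_mx_linear|exact: smooth_chi_mx|].
move=> p Z Up; have CF := in_frame_F chi_mx Z Up.
split; last first.
  apply/gskewP/(frame_cancel Up); have gF := gram_canonical Up.
  by rewrite (gram_mull gF CF) theta4_skew mulmxN mulNmx (gram_mulr gF CF).
split=> v.
  move=> /(E1P hsigma _ Up)[k ->].
  by have [C0 _ _ _] := theta4_columns CF; rewrite -scalemxAr C0 scaler0.
move=> /(E2P hU hsigma hfree _ Up)[x0 [x1 [x2 ->]]]; apply/(E1P hsigma _ Up).
exists (x1 * (Z.1 * a p + Z.2 * h p) + x2 * (Z.1 * h p + Z.2 * b p)).
exact: theta4_comb3 CF.
Qed.

Lemma one_form_psi : one_form U (gm2 U L) psi.
Proof.
apply: one_form_in_frame; [exact: psi_mx_linear|exact: smooth_psi_mx|].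
move=> p Z Up; have PF := in_frame_F psi_mx Z Up.
split=> v.
  move=> /(E2P hU hsigma hfree _ Up)[x0 [x1 [x2 ->]]].
  by rewrite (theta4_comb3 _ _ _ PF) !mulr0 addr0 scale0r.
apply/(E1P hsigma _ Up); rewrite -(mulKVmx (uF Up) v).
by rewrite (theta400_range _ PF); eexists.
Qed.

Let DTh u v w Z p (su : smooth U u) (sv : smooth U v) (sw : smooth U w) (Up : U p) :=
  derive_theta4 hU Z su sv sw Up.

Lemma chi_mx_ex : chi_mx (1, 0) = fun p => theta4 (a p) (h p) (z p).
Proof. by apply/funext => p; rewrite /chi_mx /=; congr theta4; ring. Qed.

Lemma chi_mx_ey : chi_mx (0, 1) = fun p => theta4 (h p) (b p) (z p).
Proof. by apply/funext => p; rewrite /chi_mx /=; congr theta4; ring. Qed.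

Lemma psi_mx_ex : psi_mx (1, 0) = fun p => theta4 (z p) (z p) (w1 p).
Proof. by apply/funext => p; rewrite /psi_mx /=; congr theta4; ring. Qed.

Lemma psi_mx_ey : psi_mx (0, 1) = fun p => theta4 (z p) (z p) (w2 p).
Proof. by apply/funext => p; rewrite /psi_mx /=; congr theta4; ring. Qed.

Let Dz Z p : 'D_Z z p = 0. Proof. exact: derive_cst. Qed.

Lemma ext_d_chi p : U p -> ext_d chi p (1, 0) (0, 1) *m F p = F p *m
  (theta4 (pdx h p) (pdx b p) 0 - theta4 (pdy a p) (pdy h p) 0
   + commutator (connx beta gamma V W z z z p) (theta4 (h p) (b p) 0)
   - commutator (conny beta gamma V W z z z p) (theta4 (a p) (h p) 0)).
Proof.
move=> Up; have [_ schi _] := one_form_chi.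
have := frame_ext_d hU (1, 0) (0, 1) sF Up (fun Z => DF Z Up) schi smooth_chi_mx
  (fun q Z Uq => in_frame_F chi_mx Z Uq).
rewrite chi_mx_ex chi_mx_ey /A conn_ex conn_ey.
by rewrite (DTh (1, 0) sh sb sz Up) (DTh (0, 1) sa sh sz Up) !Dz.
Qed.

Lemma ext_d_psi p : U p -> ext_d psi p (1, 0) (0, 1) *m F p = F p *m
  (theta4 0 0 (pdx w2 p) - theta4 0 0 (pdy w1 p)
   + commutator (connx beta gamma V W z z z p) (theta4 0 0 (w2 p))
   - commutator (conny beta gamma V W z z z p) (theta4 0 0 (w1 p))).
Proof.
move=> Up; have [_ spsi _] := one_form_psi.
have := frame_ext_d hU (1, 0) (0, 1) sF Up (fun Z => DF Z Up) spsi smooth_psi_mx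
  (fun q Z Uq => in_frame_F psi_mx Z Uq).
rewrite psi_mx_ex psi_mx_ey /A conn_ex conn_ey.
by rewrite (DTh (1, 0) sz sz sw2 Up) (DTh (0, 1) sz sz sw1 Up) !Dz.
Qed.

Hypothesis hpde : forall p, U p ->
  [/\ 2 * pdy beta p * b p + beta p * pdy b p =
        2 * pdx gamma p * a p + gamma p * pdx a p,
      2 * pdx b p = 2 * gamma p * pdy beta p + beta p * pdy gamma p
    & 2 * pdy a p = 2 * beta p * pdx gamma p + gamma p * pdx beta p].

Let frame_inj (B : 'M[R]_4) p : U p -> B *m F p = 0 -> B = 0.
Proof. by move=> Up E; rewrite -[B](mulmxK (uF Up)) E mul0mx. Qed.

(** structure_eq_iff_pde with c = e = t = 0, where the shifted unknowns are a
    and b themselves. *)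
Lemma ext_d_sum p : U p -> ext_d chi p (1, 0) (0, 1) + ext_d psi p (1, 0) (0, 1)
  + commutator (N p (1, 0)) (N p (0, 1)) = 0.
Proof.
move=> Up; apply: (frame_inj Up).
have NN := commutator_frame (in_frame_F n (1, 0) Up) (in_frame_F n (0, 1) Up).
apply: etrans (frameD (frameD (ext_d_chi Up) (ext_d_psi Up)) NN) _.
rewrite structure_split sym_conn_ex sym_conn_ey.
have aE : shifted_a beta z z a = a by apply/funext => q; rewrite /shifted_a /z; ring.
have bE : shifted_b gamma z z b = b by apply/funext => q; rewrite /shifted_b /z; ring.
have := structure_eq_iff_pde V W hbeta hgamma z sz sz sa sb 0 0 Up.
by rewrite aE bE => -[_ /(_ (hpde Up)) ->]; rewrite mulmx0.
Qed.

(** This is psi_equation; its last hypothesis is the first equation of the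
    system. *)
Lemma ext_d_psi_wedge p : U p ->
  ext_d psi p (1, 0) (0, 1) + wedge_bracket N chi p (1, 0) (0, 1) = 0.
Proof.
move=> Up; apply: (frame_inj Up).
have W1 := commutator_frame (in_frame_F n (1, 0) Up) (in_frame_F chi_mx (0, 1) Up).
have W2 := commutator_frame (in_frame_F n (0, 1) Up) (in_frame_F chi_mx (1, 0) Up).
apply: etrans (frameD (ext_d_psi Up) (frameB W1 W2)) _.
rewrite sym_conn_ex sym_conn_ey chi_mx_ex chi_mx_ey.
apply: etrans (congr1 (mulmx (F p)) _) (mulmx0 _ _).
have [pde1 _ _] := hpde Up.
have isd k Z (sk : smooth U k) := @is_derive_smooth _ _ k p Z sk Up.
have D1 : pdy w1 p = pdy beta p * b p + beta p * pdy b p.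
  have I := is_derive_fD (is_derive_fM (isd _ (0, 1) sz) (isd _ (0, 1) sa))
    (is_derive_fM (isd _ (0, 1) hbeta) (isd _ (0, 1) sb)).
  apply: etrans (@derive_val _ _ _ _ _ _ _ I) _.
  by rewrite Dz /z mul0r mul0r !add0r.
have D2 : pdx w2 p = pdx gamma p * a p + gamma p * pdx a p.
  have I := is_derive_fD (is_derive_fM (isd _ (1, 0) sz) (isd _ (1, 0) sb))
    (is_derive_fM (isd _ (1, 0) hgamma) (isd _ (1, 0) sa)).
  apply: etrans (@derive_val _ _ _ _ _ _ _ I) _.
  by rewrite Dz /z mul0r mul0r !add0r.
have zx : pdx z p = 0 := Dz _ _; have zy : pdy z p = 0 := Dz _ _.
have ME : Mx beta gamma z z z p = My beta gamma z z z p by rewrite /Mx /My zx zy.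
have PE : Px beta V z z p = pdy beta p + coefp beta V p.
  by rewrite /Px zx /z; ring.
have PE' : Py gamma W z z p = pdx gamma p + coefq gamma W p.
  by rewrite /Py zy /z; ring.
apply: psi_equation ME _ => //.
- by rewrite /w1 /wx /z; ring.
- by rewrite /w2 /wy /z; ring.
- by rewrite mulrC divfK.
- by rewrite mulrC divfK.
- by rewrite mulrC divfK// /z add0r.
- by rewrite mulrC divfK// /z add0r.
- rewrite PE PE' D1 D2.
  by move: (pdy beta p) (pdx gamma p) (pdy b p) (pdx a p) pde1 => *; lra.
Qed.

(** Reduction to the coordinate vectors by alternating_form. *)
Lemma psi_closed p X Y : U p -> ext_d psi p X Y + wedge_bracket N chi p X Y = 0.
Proof.
move=> Up.
have [lN _ _] := let: And4 _ _ l _ := metric_decomposition_canonical in l.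
have [lchi _ _] := one_form_chi.
rewrite (@alternating_form _ (fun X Y => ext_d psi p X Y + wedge_bracket N chi p X Y)).
- by rewrite ext_d_psi_wedge// scaler0.
- move=> k X1 Y1 Z1; rewrite (ext_d_linear hU _ _ _ _ one_form_psi Up).
  rewrite (wedge_bracket_linear _ _ _ _ (lN p Up) (lchi p Up)).
  by rewrite addrACA -scalerDr.
- by move=> X1 Y1; rewrite (ext_dC psi) (wedge_bracketC N) [RHS]opprD.
Qed.

(** By psi_closed and curvature_nonmetricity, this is the vanishing of the
    two-form of ext_d_sum. *)
Lemma chi_curvature p X Y : U p ->
  cov_ext_d omega chi p X Y = curvature omega p X Y.
Proof.
move=> Up.
have [lN _ _] := let: And4 _ _ l _ := metric_decomposition_canonical in l.
rewrite (curvature_nonmetricity hU is_metric_canonical metric_decomposition_canonical)//.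
have -> : cov_ext_d omega chi p X Y = ext_d chi p X Y + ext_d psi p X Y.
  have /eqP := psi_closed X Y Up; rewrite addr_eq0 => /eqP ->; congr (_ + _).
  exact: wedge_bracketNl.
apply/eqP; rewrite -addr_eq0; apply/eqP.
rewrite (@alternating_form _ (fun X Y => ext_d chi p X Y + ext_d psi p X Y
  + commutator (N p X) (N p Y))).
- by rewrite ext_d_sum// scaler0.
- move=> k X1 Y1 Z1; rewrite (ext_d_linear hU _ _ _ _ one_form_psi Up).
  rewrite (ext_d_linear hU _ _ _ _ one_form_chi Up) lN// commutator_linear.
  exact: scaler_add3.
- move=> X1 Y1; rewrite (ext_dC chi) (ext_dC psi) (commutatorC (N p X1)).
  by rewrite [RHS]opprD [X in _ = X + _]opprD.
Qed.

(** The metric is the one whose Gram matrix in the coordinate frame sigma,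
    sigma_x, sigma_y, sigma_xy is J4; chi and psi are given by their matrices
    in this frame, with coefficients a, b, beta gamma / 2, beta b and
    gamma a. *)
Lemma sufficiency : mobius_flat U L.
Proof.
exists g, omega, N; split; [exact: is_metric_canonical
  |exact: metric_decomposition_canonical|exact: envelopes_canonical|].
exists chi, psi; split; [exact: one_form_chi|exact: one_form_psi
  |exact: chi_curvature|exact: psi_closed].
Qed.

End Potentials.

End Sufficiency.

(** * The characterization *)

Theorem mainTheorem3 (R : realType) (U : set (R * R)) (hU : open U)
  (L : R * R -> set 'cV[R]_4) (sigma : R * R -> 'cV[R]_4)
  (hsigma : is_lift U L sigma)
  (beta gamma V W : R * R -> R)
  (hbeta : smooth U beta) (hgamma : smooth U gamma)
  (hV : smooth U V) (hW : smooth U W)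
  (hxx : forall p, U p ->
     pdx (pdx sigma) p =
       beta p *: pdy sigma p + (2^-1 * (V p - pdy beta p)) *: sigma p)
  (hyy : forall p, U p ->
     pdy (pdy sigma) p =
       gamma p *: pdx sigma p + (2^-1 * (W p - pdx gamma p)) *: sigma p)
  (hfree : forall p, U p ->
     free [:: sigma p; pdx sigma p; pdy sigma p; pdy (pdx sigma) p]) :
  mobius_flat U L <->
  exists a b : R * R -> R,
    [/\ smooth U a, smooth U b
      & forall p, U p ->
        [/\ 2 * pdy beta p * b p + beta p * pdy b p =
              2 * pdx gamma p * a p + gamma p * pdx a p,
            2 * pdx b p = 2 * gamma p * pdy beta p + beta p * pdy gamma p
          & 2 * pdy a p = 2 * beta p * pdx gamma p + gamma p * pdx beta p]].
Proof.
split=> [[g [omega [N [hg hdec henv [chi [psi [hchi hpsi chi_eq psi_eq]]]]]]]|].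
  have [f [c [e [t [sf sc se st gram]]]]] :=
    exists_adapted_frame hU hsigma hxx hyy hfree hg hdec henv.
  exact: (necessity hU hsigma hbeta hgamma hV hW hxx hyy hfree hg hdec hchi hpsi
    chi_eq psi_eq sf sc se st (fun p Up => (gram p Up).1) (fun p Up => (gram p Up).2)).
move=> [a [b [sa sb hpde]]].
exact: (sufficiency hU hsigma hbeta hgamma hV hW hxx hyy hfree sa sb hpde).
Qed.
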